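(* Let $p>2$ be a prime, $q=p^h$, and let $\mathbb K$ be the algebraic closure of $\mathbb F_q$. Let $m>2$ be an integer prime to $p$, let $a\in\mathbb K^{*}$, and let $\mathcal X$ be a nonsingular model of the irreducible curve $aX^mY^m+X^m+Y^m=1$ over $\mathbb K$. Then $G=C_m\times C_m$ is normal in $\mathrm{Aut}_{\mathbb K}(\mathcal X)$, and $$\mathrm{Aut}_{\mathbb K}(\mathcal X)/G\cong\begin{cases} C_2\times C_2, & \text{if } a\neq 1;\\ D_4, & \text{if } a=1.\end{cases}$$
   Context: Write $\mathbb K(\mathcal X)=\mathbb K(x,y)$ with $ax^my^m+x^m+y^m=1$, and let $\zeta\in\mathbb K$ be a primitive $m$-th root of unity. $G=C_m\times C_m$ is the group generated by $(x,y)\mapsto(\zeta x,y)$ and $(x,y)\mapsto(x,\zeta y)$. $\mathrm{Aut}_{\mathbb K}(\mathcal X)$ is the full automorphism group of $\mathcal X$ over $\mathbb K$; $C_2$ is the cyclic group of order $2$; $D_4$ is the dihedral group of order $8$. *)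

(* Defs.v *)
From HB Require Import structures.
From mathcomp Require Import all_boot all_order all_algebra.
From mathcomp Require Import all_fingroup all_solvable.
From mathcomp Require Import generic_quotient boolp classical_sets.

Set Implicit Arguments.
Unset Strict Implicit.
Unset Printing Implicit Defensive.

Import GRing.Theory.

Section Groups.
Local Open Scope group_scope.
Local Open Scope classical_set_scope.

Definition is_subgroup (A : groupType) (S : set A) : Prop :=
  [/\ S 1, forall s t, S s -> S t -> S (s * t) & forall s, S s -> S s^-1].

Definition is_normal (A : groupType) (S : set A) : Prop :=
  is_subgroup S /\ forall s t, S s -> S (s ^ t).

Definition subgroup_gen (A : groupType) (E : set A) : set A :=
  smallest (@is_subgroup A) E.

Definition isomorphic (A B : groupType) : Prop :=
  exists f : {multiplicative A -> B}, bijective f.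

Definition subgroup_isomorphic (A : groupType) (S : set A) (B : groupType) :
    Prop :=
  exists f : {multiplicative B -> A}, injective f /\ range f = S.

Section Quotient.
Variables (A : groupType) (N : set A) (nN : is_normal N).

Definition coset_rel : rel A := fun s t => `[< N (s^-1 * t) >].

Lemma coset_rel_refl : reflexive coset_rel.
Proof. by move=> s; apply/asboolP; rewrite mulVg; case: nN => -[]. Qed.

Lemma coset_rel_sym : symmetric coset_rel.
Proof.
have [[_ _ NV] _] := nN.
have H s t : coset_rel s t -> coset_rel t s.
  by move=> /asboolP/NV Nst; apply/asboolP; rewrite invgM invgK in Nst.
by move=> s t; apply/idP/idP; apply: H.
Qed.

Lemma coset_rel_trans : transitive coset_rel.
Proof.
have [[_ NM _] _] := nN.
move=> t s u /asboolP Nst /asboolP Ntu; apply/asboolP.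
by have := NM _ _ Nst Ntu; rewrite !mulgA mulgK.
Qed.

Definition coset_equiv : equiv_rel A :=
  EquivRel coset_rel coset_rel_refl coset_rel_sym coset_rel_trans.

Local Open Scope quotient_scope.

(* The quotient group A / N: the cosets s N, multiplied through
   representatives. *)
Definition quotient_by : Type := {eq_quot coset_equiv}.

HB.instance Definition _ := Choice.on quotient_by.
HB.instance Definition _ := EqQuotient.on quotient_by.

Definition quotient_pi (s : A) : quotient_by := \pi_({eq_quot coset_equiv}) s.
Definition quotient_one : quotient_by := quotient_pi 1.
Definition quotient_mul (c d : quotient_by) : quotient_by :=
  quotient_pi (repr c * repr d).
Definition quotient_inv (c : quotient_by) : quotient_by :=
  quotient_pi (repr c)^-1.

Lemma quotient_piP (s t : A) : N (s^-1 * t) <-> quotient_pi s = quotient_pi t.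
Proof.
split=> [Nst|/eqmodP/asboolP //].
by apply/eqmodP/asboolP.
Qed.

Lemma quotient_reprK (c : quotient_by) : quotient_pi (repr c) = c.
Proof. exact: reprK. Qed.

Lemma quotient_reprP (s : A) : N ((repr (quotient_pi s))^-1 * s).
Proof. by apply/quotient_piP; rewrite quotient_reprK. Qed.

Lemma quotient_piM (s t : A) :
  quotient_pi (s * t) = quotient_mul (quotient_pi s) (quotient_pi t).
Proof.
have [[_ NM _] NJ] := nN.
symmetry; apply/quotient_piP; rewrite invgM.
have := quotient_reprP s; have := quotient_reprP t.
set s' := repr (quotient_pi s); set t' := repr (quotient_pi t) => Nt Ns.
have -> : t'^-1 * s'^-1 * (s * t) = (s'^-1 * s) ^ t' * (t'^-1 * t).
  by rewrite conjgE !mulgA mulgK.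
by apply: NM => //; apply: NJ.
Qed.

Lemma quotient_piV (s : A) :
  quotient_pi s^-1 = quotient_inv (quotient_pi s).
Proof.
have [[_ _ NV] NJ] := nN.
symmetry; apply/quotient_piP; rewrite invgK.
have := quotient_reprP s; set s' := repr (quotient_pi s) => Ns.
have -> : s' * s^-1 = ((s'^-1 * s)^-1) ^ s'^-1.
  by rewrite conjgE invgM !invgK !mulgA mulgK.
by apply: NJ; apply: NV.
Qed.

Lemma quotient_mulA : associative quotient_mul.
Proof.
move=> c d e.
rewrite -[c]quotient_reprK -[d]quotient_reprK -[e]quotient_reprK.
by rewrite -!quotient_piM mulgA.
Qed.

Lemma quotient_mul1g : left_id quotient_one quotient_mul.
Proof. by move=> c; rewrite -[c]quotient_reprK -quotient_piM mul1g. Qed.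

Lemma quotient_mulg1 : right_id quotient_one quotient_mul.
Proof. by move=> c; rewrite -[c]quotient_reprK -quotient_piM mulg1. Qed.

Lemma quotient_mulVg : left_inverse quotient_one quotient_inv quotient_mul.
Proof.
by move=> c; rewrite -[c]quotient_reprK -quotient_piV -quotient_piM mulVg.
Qed.

Lemma quotient_mulgV : right_inverse quotient_one quotient_inv quotient_mul.
Proof.
by move=> c; rewrite -[c]quotient_reprK -quotient_piV -quotient_piM mulgV.
Qed.

HB.instance Definition _ := isGroup.Build quotient_by
  quotient_mulA quotient_mul1g quotient_mulg1 quotient_mulVg quotient_mulgV.

End Quotient.
End Groups.

Local Open Scope ring_scope.

Section FieldAutomorphisms.
Variables (K L : fieldType) (j : {rmorphism K -> L}).

Definition is_kaut (f : L -> L) : Prop :=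
  [/\ {morph f : u v / u + v}, {morph f : u v / u * v}, f 1 = 1, bijective f
    & forall c, f (j c) = j c].

(* Aut_K(L), where L is an extension of K through the embedding j; the product
   s * t is the composite s \o t. *)
Record kaut := KAut { kaut_fun :> L -> L; _ : `[< is_kaut kaut_fun >] }.

HB.instance Definition _ := [isSub for kaut_fun].
HB.instance Definition _ := [Choice of kaut by <:].

Lemma kautP (s : kaut) : is_kaut s.
Proof. by apply/asboolP; case: s. Qed.

Lemma kaut_eqP (s t : kaut) : s =1 t <-> s = t.
Proof. by split=> [|->] // st; apply: val_inj; apply: funext. Qed.

Lemma is_kaut_id : is_kaut id.
Proof. by split=> //; exists id. Qed.

Lemma is_kaut_comp (s t : kaut) : is_kaut (s \o t).
Proof.
have [sD sM s1 sB sj] := kautP s; have [tD tM t1 tB tj] := kautP t.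
split=> [u v|u v|||c] /=; rewrite ?tD ?sD ?tM ?sM ?t1 ?s1 ?tj ?sj //.
exact: bij_comp.
Qed.

Lemma kaut_surj (s : kaut) (v : L) : exists u, s u == v.
Proof. by have [_ _ _ [g _ sK] _] := kautP s; exists (g v); rewrite sK. Qed.

Definition kaut_invfun (s : kaut) (v : L) : L := xchoose (kaut_surj s v).

Lemma kaut_invfunK (s : kaut) : cancel (kaut_invfun s) s.
Proof. by move=> v; apply/eqP/(xchooseP (kaut_surj s v)). Qed.

Lemma kaut_funK (s : kaut) : cancel s (kaut_invfun s).
Proof.
by have [_ _ _ /bij_inj si _] := kautP s => v; apply: si; rewrite kaut_invfunK.
Qed.

Lemma is_kaut_inv (s : kaut) : is_kaut (kaut_invfun s).
Proof.
have [sD sM s1 /bij_inj si sj] := kautP s.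
split=> [u v|u v|||c]; try by apply: si; rewrite ?sD ?sM ?sj ?s1 !kaut_invfunK.
by exists s; [apply: kaut_invfunK|apply: kaut_funK].
Qed.

Definition kaut_one : kaut := KAut (asboolT is_kaut_id).
Definition kaut_mul (s t : kaut) : kaut := KAut (asboolT (is_kaut_comp s t)).
Definition kaut_inv (s : kaut) : kaut := KAut (asboolT (is_kaut_inv s)).

Lemma kaut_mulA : associative kaut_mul.
Proof. by move=> s t u; apply/kaut_eqP. Qed.

Lemma kaut_mul1g : left_id kaut_one kaut_mul.
Proof. by move=> s; apply/kaut_eqP. Qed.

Lemma kaut_mulg1 : right_id kaut_one kaut_mul.
Proof. by move=> s; apply/kaut_eqP. Qed.

Lemma kaut_mulVg : left_inverse kaut_one kaut_inv kaut_mul.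
Proof. by move=> s; apply/kaut_eqP => v; apply: kaut_funK. Qed.

Lemma kaut_mulgV : right_inverse kaut_one kaut_inv kaut_mul.
Proof. by move=> s; apply/kaut_eqP => v; apply: kaut_invfunK. Qed.

HB.instance Definition _ := isGroup.Build kaut
  kaut_mulA kaut_mul1g kaut_mulg1 kaut_mulVg kaut_mulgV.

End FieldAutomorphisms.

Definition irreducible_elt (R : unitRingType) (f : R) : Prop :=
  [/\ f != 0, f \isn't a GRing.unit
    & forall g h, f = g * h -> g \is a GRing.unit \/ h \is a GRing.unit].

(* That K is algebraically closed is carried by its type. *)
Definition is_algebraic_closure (F : fieldType) (K : closedFieldType)
    (iota : {rmorphism F -> K}) : Prop :=
  forall z, algebraicOver iota z.

(* Bivariate polynomials follow polyXY: X is the main variable 'X of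
   {poly {poly K}} and Y is 'Y = 'X%:P. *)
Definition curve_poly (K : fieldType) (a : K) (m : nat) : {poly {poly K}} :=
  a%:P%:P * 'X ^+ m * 'Y ^+ m + 'X ^+ m + 'Y ^+ m - 1.

Section FunctionField.
Variables (K L : fieldType) (j : {rmorphism K -> L}) (x y : L).

Definition eval_at (u : {poly {poly K}}) : L :=
  (map_poly (map_poly j) u).[x, y].

Lemma eval_at_curve (a : K) (m : nat) :
  eval_at (curve_poly a m) = j a * x ^+ m * y ^+ m + x ^+ m + y ^+ m - 1.
Proof.
rewrite /eval_at /curve_poly rmorphB rmorph1 !rmorphD !rmorphM !rmorphXn /=.
rewrite !map_polyC /= !map_polyX map_polyC.
by rewrite !(hornerE, hornerXn, horner_exp).
Qed.

(* L = K(x, y) is the fraction field of K[X, Y] / (f), with x and y the classes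
   of X and Y.  Divisibility by f is spelled out because %| on {poly {poly K}}
   denotes pseudo-divisibility. *)
Definition is_function_field (f : {poly {poly K}}) : Prop :=
  (forall u, eval_at u = 0 <-> exists v, u = v * f) /\
  (forall z, exists u v, eval_at v != 0 /\ z = eval_at u / eval_at v).

(* The group generated by (x, y) |-> (zeta x, y) and (x, y) |-> (x, zeta y);
   an element of Aut_K(K(x, y)) is determined by the images of x and y. *)
Definition torus_group (zeta : K) : set (kaut j) :=
  subgroup_gen [set s : kaut j | (s x = j zeta * x /\ s y = y) \/
                                 (s x = x /\ s y = j zeta * y)].

End FunctionField.

Arguments torus_group {K L} j x y zeta _.

(* Main.v *)
Require Import Defs.
From HB Require Import structures.
From mathcomp Require Import all_boot all_order all_algebra.
From mathcomp Require Import all_fingroup all_solvable.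
From mathcomp Require Import boolp classical_sets.
From mathcomp Require Import ring zify.

(** In P^1 x P^1 the curve is smooth of bidegree (m, m), so its genus is
    (m - 1)^2 and its regular differentials are h(x, y) omega, where
    omega = dx / f_y and h has degree at most m - 2 in each variable.  Since
    m > 2, the projections x and y are, up to homographies, the only two
    functions of degree m on the curve; hence an automorphism preserves or
    exchanges the two fibrations, and so normalises the group G of the
    rotations of x and y.  The argument below carries this out inside the
    function field L.

    Regular differentials.  Instead of omega, take the derivation D of L over K
    that is dual to it: D x = f_y and D y = - f_x.  The differential g omega is
    regular exactly when every valuation subring O of L over K satisfies
    g \in O D(O); this is the predicate [regular].  As the space of derivations
    has dimension one, an automorphism s multiplies D by a scalar of L, so up to
    a factor it maps regular elements to regular elements
    ([regular_der_kaut]).  Smoothness of the charts shows that x^i y^j is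
    regular for i, j <= m - 2 ([regular_at_monomial]).  Conversely a regular
    eigenvector of y -> zeta y is P(x) y^l with P of degree at most m - 2, and
    vanishes if l = m - 1 ([regular_eigen_poly]): this is read off the local
    rings of the affine points, and the points at infinity are moved to the
    affine part by (x, y) -> (b/x, b/y), where b^m = -1/a.

    Uniqueness of the projections.  Let g be the rotation y -> zeta y.  The
    operator sum_k zeta^k g^k projects onto the eigenvectors c(x) y^(m-1), so it
    kills every regular element.  Conjugating by an automorphism s, with
    tau = s g s^-1, gives a linear relation with nonzero coefficients between
    the values at the m points (tau^k x, tau^k y) of L^2 of all monomials of
    degree at most m - 2 in each variable.  A product of m - 2 linear forms in
    each variable isolates the point (x, y) from the m - 1 other ones, unless
    all of them share one coordinate with it; so tau fixes x or y
    ([conj_rotation_fixes_coordinate]).  An automorphism that fixes x multiplies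
    y by a root of unity, whence the normality of G.

    The quotient.  Up to the exchange of x and y, an automorphism s permutes the
    eigenspaces of G on the regular elements.  They are spanned by monomials, so
    s x = c x^k, and k = 1 or -1 because s^-1 has the same form; likewise for y.
    Substituting in the equation of the curve leaves, modulo G, the swap
    (y, x), the inversion (b/x, b/y) and, when a = 1, the flip (b x, 1/y).
    Modulo G the swap and the inversion generate a Klein four-group; the flip
    times the swap has order 4 and is inverted by the swap, which gives the
    dihedral group of order 8. *)

Set Implicit Arguments.
Unset Strict Implicit.
Unset Printing Implicit Defensive.

Import GRing.Theory.
Local Open Scope ring_scope.

(** * Evaluation of bivariate polynomials and automorphisms *)

Section Evaluation.
Variables (K L : fieldType) (j : {rmorphism K -> L}) (x y : L).
Notation ev := (eval_at j x y).

Lemma eval_at_is_zmod_morphism : zmod_morphism ev.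
Proof. by move=> u v; rewrite /eval_at rmorphB !hornerE. Qed.

Lemma eval_at_is_monoid_morphism : monoid_morphism ev.
Proof.
by split=> [|u v]; rewrite /eval_at ?rmorph1 ?rmorphM !hornerE.
Qed.

HB.instance Definition _ :=
  GRing.isZmodMorphism.Build {poly {poly K}} L ev eval_at_is_zmod_morphism.
HB.instance Definition _ :=
  GRing.isMonoidMorphism.Build {poly {poly K}} L ev eval_at_is_monoid_morphism.

Lemma eval_atB u v : ev (u - v) = ev u - ev v.
Proof. exact: rmorphB. Qed.

Lemma eval_atN u : ev (- u) = - ev u.
Proof. exact: rmorphN. Qed.

Lemma eval_atD u v : ev (u + v) = ev u + ev v.
Proof. exact: rmorphD. Qed.

Lemma eval_atM u v : ev (u * v) = ev u * ev v.
Proof. exact: rmorphM. Qed.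

Lemma eval_atXn u n : ev (u ^+ n) = ev u ^+ n.
Proof. exact: rmorphXn. Qed.

Lemma eval_at1 : ev 1 = 1.
Proof. exact: rmorph1. Qed.

Lemma eval_at0 : ev 0 = 0.
Proof. exact: rmorph0. Qed.

Lemma eval_atX : ev 'X = x.
Proof. by rewrite /eval_at map_polyX !hornerE. Qed.

Lemma eval_atC (p : {poly K}) : ev p%:P = (map_poly j p).[y].
Proof. by rewrite /eval_at map_polyC !hornerE. Qed.

Lemma eval_atCC (c : K) : ev c%:P%:P = j c.
Proof. by rewrite eval_atC map_polyC hornerC. Qed.

Lemma eval_atY : ev 'Y = y.
Proof. by rewrite eval_atC map_polyX hornerX. Qed.

End Evaluation.

Lemma eval_at_swap (K L : fieldType) (j : {rmorphism K -> L}) (x y : L) u :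
  eval_at j x y (swapXY u) = eval_at j y x u.
Proof. by rewrite /eval_at -swapXY_map horner2_swapXY. Qed.

Lemma eval_at_poly (K L : fieldType) (j : {rmorphism K -> L}) (x y : L)
  (p : {poly K}) : eval_at j x y (map_poly polyC p) = (map_poly j p).[x].
Proof. by rewrite -swapXY_polyC eval_at_swap eval_atC. Qed.

Lemma kaut_is_zmod_morphism (K L : fieldType) (j : {rmorphism K -> L})
  (s : kaut j) : zmod_morphism s.
Proof.
have [sD sM s1 _ sj] := kautP s => u v.
have sN w : s (- w) = - s w.
  by rewrite -mulN1r -[in LHS](rmorph1 j) -rmorphN sM sj rmorphN rmorph1 mulN1r.
by rewrite sD sN.
Qed.

Lemma kaut_is_monoid_morphism (K L : fieldType) (j : {rmorphism K -> L})
  (s : kaut j) : monoid_morphism s.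
Proof. by have [_ sM s1 _ _] := kautP s. Qed.

HB.instance Definition _ (K L : fieldType) (j : {rmorphism K -> L})
    (s : kaut j) :=
  GRing.isZmodMorphism.Build L L s (kaut_is_zmod_morphism s).
HB.instance Definition _ (K L : fieldType) (j : {rmorphism K -> L})
    (s : kaut j) :=
  GRing.isMonoidMorphism.Build L L s (kaut_is_monoid_morphism s).

Section KautTheory.
Variables (K L : fieldType) (j : {rmorphism K -> L}).
Implicit Types s t : kaut j.

Lemma kautj s c : s (j c) = j c.
Proof. by have [_ _ _ _] := kautP s. Qed.

Lemma kautM s t z : (s * t)%g z = s (t z).
Proof. by []. Qed.

Lemma kaut1 z : (1%g : kaut j) z = z.
Proof. by []. Qed.

Lemma kautK s : cancel s (s^-1)%g.
Proof. exact: kaut_funK. Qed.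

Lemma kautVK s : cancel (s^-1)%g s.
Proof. exact: kaut_invfunK. Qed.

Lemma kautZ s c z : s (j c * z) = j c * s z.
Proof. by rewrite rmorphM /= kautj. Qed.

Lemma kautV s z : s z^-1 = (s z)^-1.
Proof. exact: fmorphV. Qed.

Lemma expg_scale s z c i : s z = j c * z -> (s ^+ i)%g z = j (c ^+ i) * z.
Proof.
move=> sz; elim: i => [|i IHi]; first by rewrite expg0 expr0 rmorph1 mul1r.
by rewrite expgS kautM IHi kautZ sz exprSr rmorphM /= mulrA.
Qed.

Lemma expg_fix s z i : s z = z -> (s ^+ i)%g z = z.
Proof. by move=> sz; elim: i => // i IHi; rewrite expgS kautM IHi. Qed.

Lemma conj_fix s g z : (s^-1 * g * s)%g z = z <-> g (s z) = s z.
Proof.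
rewrite !kautM; split=> [E|->]; last exact: kautK.
by rewrite -[in RHS]E kautVK.
Qed.

Lemma conj_exp s g e : ((s^-1 * g * s) ^+ e = s^-1 * g ^+ e * s)%g.
Proof.
elim: e => [|e IHe]; first by rewrite !expg0 mulg1 mulVg.
by rewrite !expgS IHe !mulgA mulgK.
Qed.

Lemma kaut_eval s x y u : s (eval_at j x y u) = eval_at j (s x) (s y) u.
Proof.
rewrite /eval_at -!horner_map /= map_polyC /= -!map_poly_comp.
congr (_.[_].[_]); apply: eq_map_poly => p /=.
rewrite -!map_poly_comp; apply: eq_map_poly => c /=; exact: kautj.
Qed.

End KautTheory.

(** * The function field of the curve *)

Definition transcendental (K L : fieldType) (j : {rmorphism K -> L}) (t : L) :=
  forall c : {poly K}, c != 0 -> (map_poly j c).[t] != 0.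

Lemma curve_polyE (K : fieldType) (a : K) m :
  curve_poly a m =
  (a%:P * 'X^m + 1)%:P * 'X^m + ('X^m - 1)%:P :> {poly {poly K}}.
Proof.
rewrite /curve_poly !rmorphD rmorphN rmorphM !rmorph1 rmorphXn /=.
by rewrite mulrDl mul1r addrA -mulrA ['X^m * _ in LHS]mulrC mulrA.
Qed.

Lemma swap_curve_poly (K : fieldType) (a : K) m :
  swapXY (curve_poly a m) = curve_poly a m.
Proof.
rewrite /curve_poly rmorphB !rmorphD !rmorphM !rmorphXn rmorph1 /=.
rewrite swapXY_X swapXY_Y swapXY_polyC map_polyC /=.
by rewrite -!mulrA ['X^m * _]mulrC -!addrA (addrCA ('Y ^+ m)).
Qed.

Lemma function_field_swap (K L : fieldType) (j : {rmorphism K -> L}) (x y : L)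
    a m :
  is_function_field j x y (curve_poly a m) ->
  is_function_field j y x (curve_poly a m).
Proof.
move=> [kerP fracP]; split=> [u|z].
  rewrite -eval_at_swap kerP; split=> -[v uE].
    exists (swapXY v); apply: (can_inj (@swapXYK _)).
    by rewrite uE rmorphM /= swapXYK swap_curve_poly.
  by exists (swapXY v); rewrite uE rmorphM /= swap_curve_poly.
have [u [v [v0 ->]]] := fracP z.
by exists (swapXY u), (swapXY v); rewrite !eval_at_swap.
Qed.

Section CurveBasics.
Variables (K : closedFieldType) (L : fieldType) (j : {rmorphism K -> L}).
Variables (x y : L) (a : K) (m : nat).
Hypotheses (m_gt0 : (0 < m)%N) (a_neq0 : a != 0).
Hypothesis xyP : is_function_field j x y (curve_poly a m).
Notation f := (curve_poly a m).
Notation ev := (eval_at j x y).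

Lemma curve_eq : j a * x ^+ m * y ^+ m + x ^+ m + y ^+ m = 1.
Proof.
apply/eqP; rewrite -subr_eq0 -eval_at_curve; apply/eqP/xyP.1.
by exists 1; rewrite mul1r.
Qed.

Lemma size_curve_poly : size f = m.+1.
Proof.
have c0 : a%:P * 'X^m + 1 != 0 :> {poly K}.
  rewrite -lead_coef_eq0 lead_coefDl ?lead_coefM ?lead_coefC ?lead_coefXn ?mulr1 //.
  by rewrite size_poly1 mul_polyC size_scale // size_polyXn ltnS.
rewrite curve_polyE size_polyDl mul_polyC size_scale ?size_polyXn //.
by rewrite (leq_ltn_trans (size_polyC_leq1 _)).
Qed.

Lemma transcendentalY : transcendental j y.
Proof.
move=> c c0; apply/negP => /eqP cy0.
have /xyP.1[v cE] : ev c%:P = 0 by rewrite eval_atC.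
have v0 : v != 0.
  by apply: contraNneq c0 => v0; rewrite -polyC_eq0 cE v0 mul0r.
have f0 : f != 0 by rewrite -size_poly_gt0 size_curve_poly.
have := congr1 (fun p : {poly {poly K}} => size p) cE.
rewrite size_mul // size_curve_poly addnS /= size_polyC c0.
move: v0; rewrite -size_poly_gt0 /= => v0; rewrite -(prednK v0) => -[].
by move/esym/eqP; rewrite addn_eq0 => /andP[_ /eqP m0]; move: m_gt0; rewrite m0.
Qed.

(** Eliminating X between u and the equation: their resultant lies in the
    ideal of both, and it is nonzero because the equation has the least X-degree
    among the nonzero elements of its ideal. *)
Lemma norm_exists u : ev u != 0 ->
  exists v (c : {poly K}), c != 0 /\ ev u * ev v = (map_poly j c).[y].
Proof.
have fev : ev f = 0 by apply/xyP.1; exists 1; rewrite mul1r.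
move=> u0; have [su|su] := leqP (size u) 1.
  exists 1, u`_0; rewrite -(eval_atC j x y) -size1_polyC // rmorph1 mulr1; split=> //.
  by apply: contraNneq u0 => c0; rewrite (size1_polyC su) c0 !rmorph0.
have sf : (1 < size f)%N by rewrite size_curve_poly.
have [[v w] /= _ resE] := resultant_in_ideal su sf.
exists v, (resultant u f); split; last first.
  by rewrite -(eval_atC j x y) resE rmorphD !rmorphM /= fev mulr0 addr0 mulrC.
rewrite resultant_eq0 -leqNgt.
have [-> //|d0] := eqVneq (Pdiv.Idomain.gcdp u f) 0; first by rewrite size_poly0.
have /Pdiv.Idomain.dvdpP[[c e] /= c0 uE] := Pdiv.Idomain.dvdp_gcdl u f.
have /Pdiv.Idomain.dvdpP[[c' e'] /= c'0 fE] := Pdiv.Idomain.dvdp_gcdr u f.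
set d := Pdiv.Idomain.gcdp u f in d0 uE fE *.
have scal (b : {poly K}) w' : ev (b *: w') = (map_poly j b).[y] * ev w'.
  by rewrite -mul_polyC rmorphM /= eval_atC.
have dn0 : ev d != 0.
  apply: contraNneq u0 => d0'; have /eqP := congr1 ev uE.
  rewrite scal rmorphM /= d0' mulr0 mulf_eq0 => /orP[|//].
  by rewrite (negPf (transcendentalY _)).
have /eqP := congr1 ev fE; rewrite scal fev mulr0 rmorphM /= eq_sym.
rewrite mulf_eq0 (negPf dn0) orbF => /eqP /xyP.1[v' e'E].
have f0 : f != 0 by rewrite -size_poly_gt0 size_curve_poly.
have v'0 : v' != 0.
  apply: contraNneq c'0 => v'0; move/eqP: fE.
   rewrite e'E v'0 !mul0r -mul_polyC mulf_eq0 (negPf f0) orbF polyC_eq0.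
  by [].
have := congr1 (fun p : {poly {poly K}} => size p) fE.
rewrite e'E size_scale // !size_mul ?mulf_neq0 // size_curve_poly.
rewrite -ltnS; move: v'0; rewrite -size_poly_gt0 => v'0.
move: d0; rewrite -size_poly_gt0 => d0.
by case: (size v') v'0 => // k _; case: (size d) d0 => // l _; lia.
Qed.

End CurveBasics.

Section Fractions.
Variables (K : closedFieldType) (L : fieldType) (j : {rmorphism K -> L}).
Variables (x y : L) (a : K) (m : nat).
Hypotheses (m_gt0 : (0 < m)%N) (a_neq0 : a != 0).
Hypothesis xyP : is_function_field j x y (curve_poly a m).
Notation f := (curve_poly a m).
Notation ev := (eval_at j x y).

Lemma fraction_of z : {uv | ev uv.2 != 0 /\ z = ev uv.1 / ev uv.2}.
Proof. by apply: cid; have [u [v]] := xyP.2 z; exists (u, v). Qed.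

Definition num z := (sval (fraction_of z)).1.
Definition den z := (sval (fraction_of z)).2.

Lemma den_neq0 z : ev (den z) != 0.
Proof. by rewrite /den; case: fraction_of => uv []. Qed.

Lemma num_denE z : z = ev (num z) / ev (den z).
Proof. by rewrite /num /den; case: fraction_of => uv []. Qed.

Lemma num_den_cross u v : ev v != 0 ->
  ev (u * den (ev u / ev v)) = ev (num (ev u / ev v) * v).
Proof.
move=> v0; set z := ev u / ev v; rewrite !eval_atM; apply/eqP.
by rewrite -eqr_div ?den_neq0 // -num_denE.
Qed.

Lemma eval_at_sub_eq0 (V : zmodType) (e : {poly {poly K}} -> V) u v :
  zmod_morphism e -> (forall w, e (w * f) = 0) -> ev u = ev v -> e u = e v.
Proof.
move=> eB ef0 uv; have /xyP.1[w uvE] : ev (u - v) = 0.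
  by rewrite raddfB /= uv subrr.
by apply/eqP; rewrite -subr_eq0 -(eB u v) uvE ef0.
Qed.

Section Homomorphism.
Variables (x1 y1 : L).
Notation ev1 := (eval_at j x1 y1).
Hypotheses (x1y1 : ev1 f = 0) (y1_tr : transcendental j y1).

Lemma eval_at1_eq u v : ev u = ev v -> ev1 u = ev1 v.
Proof.
apply: eval_at_sub_eq0 => [|w]; first exact: rmorphB.
by rewrite eval_atM /= x1y1 mulr0.
Qed.

(** A point with transcendental second coordinate is generic: a nonzero norm in
    K[y] stays nonzero there, hence so does the function itself. *)
Lemma eval_at1_neq0 u : ev u != 0 -> ev1 u != 0.
Proof.
move=> /(norm_exists m_gt0 a_neq0 xyP)[v [c [c0 uvE]]].
have : ev1 u * ev1 v != 0.
  rewrite -eval_atM /= (@eval_at1_eq _ c%:P) ?eval_atM ?eval_atC //=.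
  exact: y1_tr.
by apply: contraNneq => ->; rewrite mul0r.
Qed.

Definition hom_fun z := ev1 (num z) / ev1 (den z).

Lemma hom_fun_frac u v : ev v != 0 -> hom_fun (ev u / ev v) = ev1 u / ev1 v.
Proof.
move=> v0; apply/eqP; rewrite eqr_div ?eval_at1_neq0 ?den_neq0 // -!eval_atM.
by apply/eqP/esym/eval_at1_eq/num_den_cross.
Qed.

Lemma hom_fun_eval u : hom_fun (ev u) = ev1 u.
Proof.
have -> : ev u = ev u / ev 1 by rewrite eval_at1 divr1.
by rewrite hom_fun_frac ?eval_at1 ?oner_eq0 // divr1.
Qed.

Lemma hom_fun_is_zmod_morphism : zmod_morphism hom_fun.
Proof.
move=> z w; rewrite {1}(num_denE z) {1}(num_denE w).
have [z0 w0] := (den_neq0 z, den_neq0 w).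
have [z1 w1] := (eval_at1_neq0 z0, eval_at1_neq0 w0).
rewrite -mulNr addf_div // mulNr -!eval_atM -eval_atB /=.
rewrite hom_fun_frac; last by rewrite eval_atM mulf_neq0.
rewrite /hom_fun; set d1 := ev1 (den z); set d2 := ev1 (den w).
rewrite -[X in _ = _ + X]mulNr (addf_div _ _ z1 w1) mulNr.
by rewrite eval_atB !eval_atM.
Qed.

Lemma hom_fun_is_monoid_morphism : monoid_morphism hom_fun.
Proof.
split=> [|z w]; first by rewrite -{1}(eval_at1 j x y) hom_fun_eval eval_at1.
rewrite {1}(num_denE z) {1}(num_denE w) mulf_div -!eval_atM.
rewrite hom_fun_frac; last by rewrite eval_atM mulf_neq0 ?den_neq0.
by rewrite /hom_fun mulf_div -!eval_atM.
Qed.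

HB.instance Definition _ :=
  GRing.isZmodMorphism.Build L L hom_fun hom_fun_is_zmod_morphism.
HB.instance Definition _ :=
  GRing.isMonoidMorphism.Build L L hom_fun hom_fun_is_monoid_morphism.

(** Every generic point of the curve over L defines an endomorphism of L; it is
    an automorphism as soon as x and y are attained. *)
Lemma kaut_exists :
  (forall g : {rmorphism L -> L}, (forall c, g (j c) = j c) -> g x = x1 ->
     g y = y1 -> exists px py, g px = x /\ g py = y) ->
  exists s : kaut j, s x = x1 /\ s y = y1.
Proof.
move=> onto.
have hj c : hom_fun (j c) = j c by rewrite -{1}(eval_atCC j x y) hom_fun_eval eval_atCC.
have hx : hom_fun x = x1 by rewrite -{1}(eval_atX j x y) hom_fun_eval eval_atX.
have hy : hom_fun y = y1 by rewrite -{1}(eval_atY j x y) hom_fun_eval eval_atY.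
have [px [py [pxE pyE]]] := onto hom_fun hj hx hy.
have evp u : hom_fun (eval_at j px py u) = ev u.
  rewrite /eval_at -!horner_map /= map_polyC /= -!map_poly_comp pxE pyE.
  congr (_.[_].[_]); apply: eq_map_poly => q /=.
  by rewrite -!map_poly_comp; apply: eq_map_poly => c /=.
have sP : is_kaut j hom_fun.
  split=> //; [exact: rmorphD|exact: rmorphM|exact: rmorph1|].
  exists (fun z => eval_at j px py (num z) / eval_at j px py (den z)) => z.
    by apply: (fmorph_inj hom_fun); rewrite fmorph_div /= !evp -num_denE.
  by rewrite fmorph_div /= !evp -num_denE.
by exists (KAut (asboolT sP)).
Qed.

End Homomorphism.

Lemma kaut_ext (s t : kaut j) : s x = t x -> s y = t y -> s = t.
Proof.
move=> sx sy; apply/kaut_eqP => z.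
by rewrite (num_denE z) !fmorph_div /= !kaut_eval sx sy.
Qed.

End Fractions.

(** The situation is symmetric in x and y, so that each statement on x yields
    one on y. *)
Record curve_setting (K : closedFieldType) (L : fieldType)
    (j : {rmorphism K -> L}) (x y : L) (a zeta : K) (m : nat) : Prop :=
  CurveSetting {
    cs_m_gt2 : (2 < m)%N;
    cs_a_neq0 : a != 0;
    cs_function_field : is_function_field j x y (curve_poly a m);
    cs_zeta_prim : m.-primitive_root zeta }.

Lemma curve_setting_swap (K : closedFieldType) (L : fieldType)
    (j : {rmorphism K -> L}) (x y : L) (a zeta : K) (m : nat) :
  curve_setting j x y a zeta m -> curve_setting j y x a zeta m.
Proof. by case=> *; split=> //; apply: function_field_swap. Qed.

Section SettingBasics.
Variables (K : closedFieldType) (L : fieldType) (j : {rmorphism K -> L}).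
Variables (x y : L) (a zeta : K) (m : nat).
Hypothesis S : curve_setting j x y a zeta m.

Lemma cs_m_gt0 : (0 < m)%N.
Proof. by apply: leq_trans (cs_m_gt2 S). Qed.

Lemma cs_curve_eq : j a * x ^+ m * y ^+ m + x ^+ m + y ^+ m = 1.
Proof. exact: curve_eq (cs_function_field S). Qed.

Lemma cs_kummer_eq : y ^+ m * (j a * x ^+ m + 1) = 1 - x ^+ m.
Proof. by rewrite -[X in X - _]cs_curve_eq; ring. Qed.

Lemma cs_transcendentalY : transcendental j y.
Proof. exact: transcendentalY cs_m_gt0 (cs_a_neq0 S) (cs_function_field S). Qed.

Lemma cs_y_neq0 : y != 0.
Proof.
by have := cs_transcendentalY (negbT (polyX_eq0 K)); rewrite map_polyX hornerX.
Qed.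

Lemma cs_mK_neq0 : m%:R != 0 :> K.
Proof. exact: prim_root_natf_neq0 (cs_zeta_prim S). Qed.

Lemma cs_m_neq0 : m%:R != 0 :> L.
Proof. by rewrite -(rmorph_nat j) fmorph_eq0 cs_mK_neq0. Qed.

Lemma unity_root_neq0 (e : K) : e ^+ m = 1 -> e != 0.
Proof.
apply: contra_eq_neq => ->.
by rewrite expr0n gtn_eqF ?cs_m_gt0 // eq_sym oner_neq0.
Qed.

Lemma cs_zeta_neq0 : zeta != 0.
Proof. by rewrite (prim_root_eq0 (cs_zeta_prim S)) -lt0n cs_m_gt0. Qed.

Lemma XnsubC_neq0 n (c : K) : (0 < n)%N -> 'X^n - c%:P != 0 :> {poly K}.
Proof. by move=> n0; rewrite -size_poly_gt0 size_XnsubC. Qed.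

Lemma binomial_horner (c d : K) n (t : L) :
  (map_poly j (c *: 'X^n - d%:P)).[t] = j c * t ^+ n - j d.
Proof.
by rewrite rmorphB /= map_polyC -mul_polyC rmorphM /= map_polyC map_polyXn !hornerE.
Qed.

Lemma cs_y_power_nonconstant n (c d : K) : (0 < n)%N -> c != 0 -> j c * y ^+ n != j d.
Proof.
move=> n0 c0; rewrite -subr_eq0 -binomial_horner; apply: cs_transcendentalY.
have -> : d = c * (c^-1 * d) by rewrite mulVKf.
by rewrite polyCM mul_polyC -scalerBr scaler_eq0 (negPf c0) XnsubC_neq0.
Qed.

End SettingBasics.

Section PartialDerivatives.
Variables (K : closedFieldType) (L : fieldType) (j : {rmorphism K -> L}).
Variables (x y : L) (a zeta : K) (m : nat).
Hypothesis S : curve_setting j x y a zeta m.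
Let S' := curve_setting_swap S.

(** For a = -1 the equation splits as (1 - x^m) (1 - y^m) = 0, so that x or y
    would be a root of unity. *)
Lemma cs_a1_neq0 : a + 1 != 0.
Proof.
apply/negP => /eqP a1.
have aE : a = -1 by apply/eqP; rewrite -addr_eq0 a1.
have xyE := cs_curve_eq S.
have /eqP : (1 - x ^+ m) * (1 - y ^+ m) = 0.
  have -> : (1 - x ^+ m) * (1 - y ^+ m) =
      1 - (-1 * x ^+ m * y ^+ m + x ^+ m + y ^+ m) by ring.
  by move: xyE; rewrite aE rmorphN rmorph1 => ->; rewrite subrr.
have neq1 t : j 1 * t ^+ m != j 1 -> 1 - t ^+ m != 0.
  by rewrite rmorph1 mul1r subr_eq0 eq_sym.
rewrite mulf_eq0 => /orP[]; apply/negP/neq1.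
  exact: (cs_y_power_nonconstant S' _ (cs_m_gt0 S) (oner_neq0 K)).
exact: (cs_y_power_nonconstant S _ (cs_m_gt0 S) (oner_neq0 K)).
Qed.

Definition cs_fx := m%:R * x ^+ m.-1 * (j a * y ^+ m + 1).
Definition cs_fy := m%:R * y ^+ m.-1 * (j a * x ^+ m + 1).

Lemma cs_au1_neq0 : j a * x ^+ m + 1 != 0.
Proof.
have := cs_y_power_nonconstant S' (-1) (cs_m_gt0 S) (cs_a_neq0 S).
by rewrite rmorphN rmorph1 -addr_eq0.
Qed.

Lemma cs_fy_neq0 : cs_fy != 0.
Proof.
by rewrite !mulf_neq0 ?expf_neq0 ?(cs_y_neq0 S) ?(cs_m_neq0 S) // cs_au1_neq0.
Qed.

Definition dX (u : {poly {poly K}}) : {poly {poly K}} := u^`().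
(** The partial derivative in Y, obtained from that in X by exchanging the
    variables so that Leibniz' rule is inherited. *)
Definition dY (u : {poly {poly K}}) : {poly {poly K}} := swapXY (dX (swapXY u)).

Lemma ev_dX_curve : eval_at j x y (dX (curve_poly a m)) = cs_fx.
Proof.
rewrite /dX curve_polyE derivD derivC addr0 mul_polyC derivZ derivXn -mul_polyC.
rewrite eval_atM -mulr_natr eval_atM eval_atXn eval_atC eval_atX.
rewrite !(rmorphD, rmorphM, rmorphXn, rmorph1, rmorph_nat) /=.
rewrite map_polyC map_polyX !(hornerE, horner_exp) /cs_fx /=; ring.
Qed.
End PartialDerivatives.

(** * Derivations of the function field *)

Section Derivations.
Variables (K : closedFieldType) (L : fieldType) (j : {rmorphism K -> L}).
Variables (x y : L) (a zeta : K) (m : nat).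
Hypothesis S : curve_setting j x y a zeta m.
Notation f := (curve_poly a m).
Notation ev := (eval_at j x y).
Notation fx := (cs_fx j x y a m).
Notation fy := (cs_fy j x y a m).

Lemma ev_dY_curve : ev (dY f) = fy.
Proof. by rewrite /dY swap_curve_poly eval_at_swap ev_dX_curve. Qed.

Section DerivationAlong.
Variables (s : {rmorphism L -> L}) (E : L -> L).

(** Leibniz' rule twisted by s covers both the derivations of L, with s the
    identity, and the maps D \o s and s \o D, which must be compared. *)
Definition derivation_along : Prop :=
  [/\ forall z w, E (z + w) = E z + E w,
      forall z w, E (z * w) = s z * E w + E z * s w
    & forall c, E (j c) = 0].
Hypothesis sj : forall c, s (j c) = j c.
Hypothesis E_der : derivation_along.

Lemma der_exp z k : E (z ^+ k.+1) = s z ^+ k * E z * k.+1%:R.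
Proof.
have [_ EM _] := E_der; elim: k => [|k IHk]; first by rewrite !expr1 expr0; ring.
by rewrite exprS EM IHk rmorphXn /= -[in RHS]natr1 !exprS; ring.
Qed.

Lemma der_curve : s fx * E x + s fy * E y = 0.
Proof.
have [ED EM Ej] := E_der.
have E1 : E 1 = 0 by rewrite -{1}(rmorph1 j) Ej.
have := congr1 E (cs_curve_eq S); rewrite E1.
rewrite !ED !EM Ej /cs_fx /cs_fy.
rewrite !(rmorphD, rmorphM, rmorphXn, rmorph1, rmorph_nat) /= !sj.
rewrite -(prednK (cs_m_gt0 S)) !der_exp => <-.
rewrite !exprS; ring.
Qed.

(** Derivations form a line: the relation f_x E x + f_y E y = 0 with f_y != 0
    makes E y, and then E, depend on E x only. *)
Lemma der_eq0 : E x = 0 -> forall z, E z = 0.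
Proof.
move=> Ex0; have Ey0 : E y = 0.
  have := der_curve; rewrite Ex0 mulr0 add0r => /eqP.
  by rewrite mulf_eq0 fmorph_eq0 (negPf (cs_fy_neq0 S)) /= => /eqP.
have [ED EM Ej] := E_der.
have E0 : E 0 = 0 by rewrite -{1}(rmorph0 j) Ej.
have Eev u : E (ev u) = 0.
  elim/poly_ind: u => [|u c IHu]; first by rewrite eval_at0.
  rewrite eval_atD eval_atM eval_atX ED EM IHu Ex0 !(mulr0, mul0r, add0r).
  elim/poly_ind: c => [|c d IHc]; first by rewrite eval_at0.
  rewrite polyCD polyCM eval_atD eval_atM eval_atY eval_atCC ED EM IHc Ey0 Ej.
  by rewrite !(mulr0, mul0r, add0r).
move=> z; have := Eev (num (cs_function_field S) z).
have v0 := den_neq0 (cs_function_field S) z.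
have -> : ev (num (cs_function_field S) z) = z * ev (den (cs_function_field S) z).
  by rewrite {2}(num_denE (cs_function_field S) z) divfK.
rewrite EM Eev mulr0 add0r => /eqP.
by rewrite mulf_eq0 fmorph_eq0 (negPf v0) orbF => /eqP.
Qed.

End DerivationAlong.

End Derivations.

Section Derivation.
Variables (K : closedFieldType) (L : fieldType) (j : {rmorphism K -> L}).
Variables (x y : L) (a zeta : K) (m : nat).
Hypothesis S : curve_setting j x y a zeta m.
Notation f := (curve_poly a m).
Notation ev := (eval_at j x y).
Notation fx := (cs_fx j x y a m).
Notation fy := (cs_fy j x y a m).
Notation num := (num (cs_function_field S)).
Notation den := (den (cs_function_field S)).
Let num_denE := num_denE (cs_function_field S).
Let den_neq0 := den_neq0 (cs_function_field S).

Lemma dYM (u v : {poly {poly K}}) : dY (u * v) = dY u * v + u * dY v.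
Proof. by rewrite /dY /dX rmorphM derivM rmorphD !rmorphM /= !swapXYK. Qed.

Lemma dYB (u v : {poly {poly K}}) : dY (u - v) = dY u - dY v.
Proof.
have sB (w w' : {poly {poly K}}) : swapXY (w - w') = swapXY w - swapXY w'.
  exact: swapXY_is_zmod_morphism.
by rewrite /dY /dX sB derivB sB.
Qed.

(** The bracket of u with the equation: it is a derivation that kills the
    equation, hence descends to K[x, y]. *)
Definition der_poly (u : {poly {poly K}}) := dX u * dY f - dY u * dX f.

Lemma der_polyM u v : der_poly (u * v) = der_poly u * v + u * der_poly v.
Proof. by rewrite /der_poly /dX derivM dYM; ring. Qed.

Lemma der_polyB u v : der_poly (u - v) = der_poly u - der_poly v.
Proof.
have subC (R : pzRingType) (A B C E P Q : R) :
    (A - B) * P - (C - E) * Q = A * P - C * Q - (B * P - E * Q).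
  by rewrite !mulrBl !opprD !opprK !addrA; congr (_ + _); rewrite addrAC.
by rewrite /der_poly /dX derivB (dYB u v) subC.
Qed.

Notation d u := (ev (der_poly u)).

Lemma ev_der_polyM u v : d (u * v) = d u * ev v + ev u * d v.
Proof. by rewrite der_polyM eval_atD !eval_atM. Qed.

Lemma ev_der_polyD u v : d (u + v) = d u + d v.
Proof.
have := der_polyB (u + v) v; rewrite addrK => /(congr1 ev).
by rewrite (eval_atB _ _ _ (der_poly (u + v))) => ->; rewrite subrK.
Qed.

Lemma ev_der_poly_eq u v : ev u = ev v -> d u = d v.
Proof.
apply: (eval_at_sub_eq0 (cs_function_field S) (e := fun u => d u)) => [u' v'|w] /=.
  by rewrite der_polyB eval_atB.
rewrite der_polyM eval_atD !eval_atM.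
have -> : ev f = 0 by apply/(cs_function_field S).1; exists 1; rewrite mul1r.
have -> : der_poly f = 0 by rewrite /der_poly mulrC subrr.
by rewrite eval_at0 !mulr0 addr0.
Qed.

Definition der (z : L) : L :=
  (d (num z) * ev (den z) - ev (num z) * d (den z)) / ev (den z) ^+ 2.

Lemma der_frac u v : ev v != 0 ->
  der (ev u / ev v) = (d u * ev v - ev u * d v) / ev v ^+ 2.
Proof.
move=> v0; rewrite /der; set z := ev u / ev v.
have v'0 := den_neq0 z; set u' := num z; set v' := den z in v'0 *.
have h1 : ev (u * v') = ev (u' * v) by apply: num_den_cross.
have h2 := ev_der_poly_eq h1.
rewrite !ev_der_polyM in h2; rewrite !eval_atM in h1.
apply/eqP; rewrite eqr_div ?expf_neq0 //; apply/eqP.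
move: h1 h2; set U := ev u; set V := ev v; set U' := ev u'; set V' := ev v'.
set dU := d u; set dV := d v; set dU' := d u'; set dV' := d v' => h1 h2.
have -> : (dU' * V' - U' * dV') * V ^+ 2 =
    V * V' * (dU' * V) - (U' * V) * V * dV' by ring.
have -> : dU' * V = dU * V' + U * dV' - U' * dV by rewrite h2; ring.
rewrite mulrBr mulrDr.
have -> : V * V' * (U' * dV) = (U' * V) * V' * dV by ring.
by rewrite -h1; ring.
Qed.

Lemma der_eval u : der (ev u) = d u.
Proof.
have -> : ev u = ev u / ev 1 by rewrite eval_at1 divr1.
rewrite der_frac ?eval_at1 ?oner_eq0 // expr1n !divr1 mulr1.
have -> : der_poly 1 = 0.
  by have := der_polyM 1 1; rewrite !mulr1 mul1r -[LHS]addr0 => /addrI.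
by rewrite eval_at0 mulr0 subr0.
Qed.

Lemma der_is_derivation : derivation_along j idfun der.
Proof.
split=> [z w|z w|c] /=.
- have [z0 w0] := (den_neq0 z, den_neq0 w).
  rewrite {1}(num_denE z) {1}(num_denE w) addf_div // -!eval_atM -eval_atD.
  rewrite der_frac; last by rewrite eval_atM mulf_neq0.
  rewrite /der ev_der_polyD !ev_der_polyM eval_atD !eval_atM.
  set A := ev (num z); set A' := ev (num w); set dA := d (num z).
  set dA' := d (num w); set dB := d (den z); set dB' := d (den w).
  by move: z0 w0; set B := ev _; set B' := ev _ => z0 w0; field; rewrite z0 w0.
- have [z0 w0] := (den_neq0 z, den_neq0 w).
  rewrite {1}(num_denE z) {1}(num_denE w) mulf_div -!eval_atM.
  rewrite der_frac; last by rewrite eval_atM mulf_neq0.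
  rewrite [X in _ = X * _ + _](num_denE z) [X in _ = _ + _ * X](num_denE w).
  rewrite /der !ev_der_polyM !eval_atM.
  set A := ev (num z); set A' := ev (num w); set dA := d (num z).
  set dA' := d (num w); set dB := d (den z); set dB' := d (den w).
  by move: z0 w0; set B := ev _; set B' := ev _ => z0 w0; field; rewrite z0 w0.
rewrite -(eval_atCC j x y) der_eval /der_poly /dY /dX swapXY_polyC map_polyC.
by rewrite derivC rmorph0 !mul0r subr0 eval_at0.
Qed.

Lemma der_x : der x = fy.
Proof.
rewrite -{1}(eval_atX j x y) der_eval /der_poly /dX derivX mul1r {2}/dY /dX.
by rewrite swapXY_X derivC rmorph0 mul0r subr0 ev_dY_curve.
Qed.

Lemma der_y : der y = - fx.
Proof.
rewrite -{1}(eval_atY j x y) der_eval /der_poly /dX derivC mul0r /dY /dX.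
by rewrite swapXY_Y derivX rmorph1 mul1r sub0r eval_atN ev_dX_curve.
Qed.

End Derivation.

(** * Valuation subrings and regular elements *)

Section Valuations.
Variables (K L : fieldType) (j : {rmorphism K -> L}).

(** The condition mentions no coordinates, so that automorphisms of L permute
    these subrings. *)
Definition valuation_subring (O : L -> Prop) : Prop :=
  [/\ forall c, O (j c), forall z w, O z -> O w -> O (z + w),
      forall z w, O z -> O w -> O (z * w) & forall z, O z \/ O z^-1].

(** Membership of g in O D(O).  Taking a single product o * D z is enough,
    because divisibility in O is total. *)
Definition regular_at (D : L -> L) (O : L -> Prop) (g : L) : Prop :=
  exists o z, [/\ O o, O z & g = o * D z].

(** Regularity of the differential g omega, for the differential omega dual
    to D: its value at D is g, and it is regular at O when it lies in O d(O). *)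
Definition regular (D : L -> L) (g : L) : Prop :=
  forall O, valuation_subring O -> regular_at D O g.

Section ValuationTheory.
Variables (O : L -> Prop) (D : L -> L).
Hypothesis O_val : valuation_subring O.

Lemma valC c : O (j c). Proof. by case: O_val. Qed.
Lemma valD z w : O z -> O w -> O (z + w). Proof. by case: O_val => _ + _ _; apply. Qed.
Lemma valM z w : O z -> O w -> O (z * w). Proof. by case: O_val => _ _ + _; apply. Qed.
Lemma val1 : O 1. Proof. by rewrite -(rmorph1 j); apply: valC. Qed.
Lemma valN z : O z -> O (- z).
Proof. by move=> Oz; rewrite -mulN1r -(rmorph1 j) -rmorphN; apply: valM (valC _) Oz. Qed.
Lemma valX z k : O z -> O (z ^+ k).
Proof.
by move=> Oz; elim: k => [|k IHk]; [apply: val1|rewrite exprS; apply: valM].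
Qed.

Lemma regular_atM o g : O o -> regular_at D O g -> regular_at D O (o * g).
Proof.
move=> Oo [o' [z [Oo' Oz ->]]]; exists (o * o'), z; rewrite mulrA; split=> //.
exact: valM.
Qed.

Lemma regular_atD g1 g2 :
  regular_at D O g1 -> regular_at D O g2 -> regular_at D O (g1 + g2).
Proof.
move=> [o1 [z1 [Oo1 Oz1 ->]]] [o2 [z2 [Oo2 Oz2 ->]]].
(* D z1 and D z2 are comparable for divisibility in O. *)
have [D10|D10] := eqVneq (D z1) 0.
  by exists o2, z2; rewrite D10 mulr0 add0r.
have [D20|D20] := eqVneq (D z2) 0.
  by exists o1, z1; rewrite D20 mulr0 addr0.
have [_ _ _ /(_ (D z2 / D z1))[Oq|]] := O_val.
  exists (o1 + o2 * (D z2 / D z1)), z1; split=> //; last by field; apply/D10.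
  by apply: valD => //; apply: valM.
rewrite invfM invrK mulrC => Oq.
exists (o1 * (D z1 / D z2) + o2), z2; split=> //; last by field; apply/D20.
by apply: valD => //; apply: valM.
Qed.

End ValuationTheory.

Lemma regularD D g1 g2 : regular D g1 -> regular D g2 -> regular D (g1 + g2).
Proof. by move=> R1 R2 O OV; apply: regular_atD (R1 O OV) (R2 O OV). Qed.

Lemma regularZ D c g : regular D g -> regular D (j c * g).
Proof. by move=> Rg O OV; apply: regular_atM (Rg O OV) => //; apply: valC. Qed.

Lemma regular0 (D : L -> L) : regular D 0.
Proof.
by move=> O OV; exists 0, 0; rewrite mul0r -(rmorph0 j); split=> //; apply: valC.
Qed.

Lemma regular_sum D (I : finType) (F : I -> L) :
  (forall i, regular D (F i)) -> regular D (\sum_i F i).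
Proof. by move=> RF; apply: big_ind => [||i _]; [exact: regular0|exact: regularD|]. Qed.

Lemma valuation_subring_preim (s : kaut j) O :
  valuation_subring O -> valuation_subring (O \o s).
Proof.
move=> [OC OD OM OV]; split=> [c|z w|z w|z] /=.
- by rewrite kautj.
- by rewrite rmorphD; apply: OD.
- by rewrite rmorphM; apply: OM.
- by rewrite fmorphV; apply: OV.
Qed.

(** The preimage by s of a valuation subring is one, and the factor c accounts
    for the change of D. *)
Lemma regular_kaut (D : L -> L) (s : kaut j) (c : L) :
  (forall z, D (s z) = c * s (D z)) -> forall g, regular D g -> regular D (c * s g).
Proof.
move=> Ds g Rg O OV.
have [o [z [Oo Oz ->]]] := Rg _ (valuation_subring_preim s OV).
exists (s o), (s z); split=> //.
by rewrite rmorphM Ds /=; ring.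
Qed.

End Valuations.

Section RegularMonomials.
Variables (K : closedFieldType) (L : fieldType) (j : {rmorphism K -> L}).
Variables (a zeta : K) (m : nat).
Variables (D : L -> L) (O : L -> Prop).
Hypotheses (D_der : derivation_along j idfun D) (O_val : valuation_subring j O).

Section Charts.
Variables (x y e : L).
Hypothesis S : curve_setting j x y a zeta m.
Notation fx := (cs_fx j x y a m).
Notation fy := (cs_fy j x y a m).
Hypotheses (e_neq0 : e != 0) (Oe : O e^-1).
Hypotheses (Dx : D x = e * fy) (Dy : D y = - (e * fx)).

Let mE : exists n, m = n.+2.
Proof. by have := cs_m_gt2 S; case: (m) => [|[|k]] // _; exists k. Qed.

Let a10 : j a + 1 != 0.
Proof. by rewrite -(rmorph1 j) -rmorphD fmorph_eq0 (cs_a1_neq0 S). Qed.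

Let Om : O m%:R^-1.
Proof. by rewrite -(rmorph_nat j) -fmorphV; apply: (valC O_val). Qed.

Let Oa : O (j a + 1)^-1.
Proof. by rewrite -(rmorph1 j) -rmorphD -fmorphV; apply: (valC O_val). Qed.

(** The curve has no singular point with both coordinates finite: 1 is a
    combination of f_x and f_y with coefficients in K[x, y]. *)
Lemma regular_at_affine : O x -> O y -> regular_at D O 1.
Proof.
move=> Ox Oy; have vE := cs_curve_eq S; have m0 := cs_m_neq0 S.
(* With p = x f_x / m = 1 - y^m and q = y f_y / m = 1 - x^m, the equation of the
   curve reads 1 = p + q - a / (a + 1) p q. *)
have -> : 1 = (e^-1 * (y * m%:R^-1)) * D x +
    (- (e^-1 * (x * m%:R^-1) * (1 + - (j a * (j a + 1)^-1 * (1 + - x ^+ m))))) * D y.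
  rewrite Dx Dy /cs_fx /cs_fy -[in RHS](prednK (cs_m_gt0 S)).
  have xm : x ^+ m = x * x ^+ m.-1 by rewrite -exprS prednK // (cs_m_gt0 S).
  have ym : y ^+ m = y * y ^+ m.-1 by rewrite -exprS prednK // (cs_m_gt0 S).
  rewrite (prednK (cs_m_gt0 S)).
  transitivity (y ^+ m * (j a * x ^+ m + 1) + x ^+ m * (j a * y ^+ m + 1) *
     (1 - j a / (j a + 1) * (1 - x ^+ m))); last first.
    by rewrite xm ym; field; rewrite a10 m0 e_neq0.
  move: vE; set u := x ^+ m; set v := y ^+ m; set b := j a => vE.
  have key : (b * u + 1) * (b * v + 1) = b + 1.
    transitivity (b * (b * u * v + u + v) + 1); first by ring.
    by rewrite vE mulr1.
  have ab : b + 1 != 0 := a10.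
  apply: (mulfI ab); rewrite mulr1.
  transitivity ((b * u + 1) * (b * v + (b * u * v + u + v))).
    by rewrite vE key.
  by field; exact: ab.
apply: (regular_atD O_val); apply: (regular_atM O_val).
- by apply: (valM O_val) => //; apply: (valM O_val).
- by exists 1, x; rewrite mul1r; split=> //; apply: (val1 O_val).
- apply: (valN O_val); apply: (valM O_val).
    by do 2!apply: (valM O_val) => //.
  apply: (valD O_val) => //; first exact: (val1 O_val).
  apply: (valN O_val) => //; apply: (valM O_val) => //.
    by apply: (valM O_val) => //; apply: (valC O_val).
  apply: (valD O_val) => //; first exact: (val1 O_val).
  by apply: (valN O_val) => //; apply: (valX O_val).
- by exists 1, y; rewrite mul1r; split=> //; apply: (val1 O_val).
Qed.

Lemma der_inv : D x^-1 = - (x^-1 ^+ 2 * D x).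
Proof.
have x0 := cs_y_neq0 (curve_setting_swap S).
have [_ DM Dj] := D_der; have := DM x x^-1; rewrite /= divff //.
rewrite -{1}(rmorph1 j) Dj => /esym/eqP; rewrite addr_eq0 => /eqP xD.
by apply: (mulfI x0); rewrite xD expr2; field.
Qed.

(** Where x has a pole and y has none, 1/x and y are coordinates of a smooth
    chart in which omega acquires the factor x^(2 - m); hence the bound m - 2 on
    the degree in x. *)
Lemma regular_at_infinity : O x^-1 -> O y -> regular_at D O (x ^+ m.-2).
Proof.
move=> Ox Oy; have [n mn] := mE.
have vE := cs_curve_eq S; have m0 := cs_m_neq0 S.
have x0 := cs_y_neq0 (curve_setting_swap S).
(* With u = x^-m, p = u (1 - y^m) and q = y^m (a + u) = u - 1, the equation of
   the curve reads 1 = p (1 + q / (a + 1)) - q. *)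
have -> : x ^+ m.-2 = (e^-1 * (y * m%:R^-1)) * D x^-1 +
    (- (e^-1 * (x^-1 * m%:R^-1) * (1 + (x^-1 ^+ m + -1) * (j a + 1)^-1))) * D y.
  rewrite der_inv Dx Dy /cs_fx /cs_fy; move: vE m0; rewrite mn /=.
  move: (n.+2%:R : L) => M; set b := j a; set Y := y ^+ n; set X := x ^+ n.
  rewrite !exprS -/X -/Y !exprVn -/X => vE m0.
  have X0 : X != 0 by rewrite expf_neq0.
  have ab : b + 1 != 0 := a10.
  have u0 : x * (x * X) != 0 by rewrite !mulf_neq0.
  apply: (mulfI ab); apply: (mulfI u0).
  transitivity (X * ((b * (x * (x * X)) + 1) * (1 - y * (y * Y)))); last first.
    by field; rewrite m0 e_neq0 X0 x0 [j a + 1 != 0]ab oner_eq0.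
  move: vE; set u := x * (x * X); set v := y * (y * Y) => vE.
  have -> : 1 - v = u * (b * v + 1) by rewrite -[X in X - v]vE; ring.
  transitivity (X * u * (b * (b * u * v + u + v) + 1)); last by ring.
  by rewrite vE; ring.
rewrite addrC; apply: (regular_atD O_val); apply: (regular_atM O_val).
- apply: (valN O_val); apply: (valM O_val).
    by do 2!apply: (valM O_val) => //.
  apply: (valD O_val); first exact: (val1 O_val).
  apply: (valM O_val) => //; apply: (valD O_val); first by apply: (valX O_val).
  by apply: (valN O_val); apply: (val1 O_val).
- by exists 1, y; rewrite mul1r; split=> //; apply: (val1 O_val).
- by apply: (valM O_val) => //; apply: (valM O_val).
- by exists 1, x^-1; rewrite mul1r; split=> //; apply: (val1 O_val).
Qed.

Lemma regular_at_monomial_half k l : (k <= m.-2)%N -> O y ->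
  regular_at D O (x ^+ k * y ^+ l).
Proof.
move=> km Oy; have [_ _ _ /(_ x)[Ox|Ox]] := O_val.
  rewrite -[_ * _]mulr1; apply: (regular_atM O_val); last exact: regular_at_affine.
  by apply: (valM O_val); apply: (valX O_val).
have x0 := cs_y_neq0 (curve_setting_swap S).
have -> : x ^+ k * y ^+ l = x^-1 ^+ (m.-2 - k) * y ^+ l * x ^+ m.-2.
  rewrite mulrAC -[in X in _ = _ * X * _](subnK km) exprD mulrA exprVn mulVf ?mul1r //.
  by rewrite expf_neq0.
apply: (regular_atM O_val); last exact: regular_at_infinity.
by apply: (valM O_val); apply: (valX O_val).
Qed.

End Charts.

Lemma regular_at_monomial (x y : L) k l :
  curve_setting j x y a zeta m ->
  D x = cs_fy j x y a m -> D y = - cs_fx j x y a m ->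
  (k <= m.-2)%N -> (l <= m.-2)%N -> regular_at D O (x ^+ k * y ^+ l).
Proof.
move=> S Dx Dy km lm; have S' := curve_setting_swap S.
have [OC OD OM OV] := O_val.
have ON1 : O (-1)^-1 by rewrite invrN1 -(rmorph1 j) -rmorphN.
have [Oy|Oy'] := pselect (O y).
  apply: (regular_at_monomial_half (e := 1) S) => //; rewrite ?oner_eq0 ?mul1r //.
  by rewrite invr1; apply: (val1 O_val).
have [Ox|Ox'] := pselect (O x).
  rewrite mulrC; apply: (regular_at_monomial_half (e := -1) S') => //.
  - by rewrite oppr_eq0 oner_eq0.
  - by rewrite Dy mulN1r /cs_fx /cs_fy.
  - by rewrite Dx mulN1r opprK /cs_fx /cs_fy.
(* x and y cannot both have a pole. *)
exfalso.
have x0 := cs_y_neq0 S'; have y0 := cs_y_neq0 S.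
have Ox : O x^-1 by case: (OV x).
have Oy : O y^-1 by case: (OV y).
have m0 : (0 < m)%N := cs_m_gt0 S.
have aE : j a = x^-1 ^+ m * (y^-1 ^+ m + -1) + - y^-1 ^+ m.
  have := cs_curve_eq S; rewrite !exprVn.
  have : x ^+ m != 0 by rewrite expf_neq0.
  have : y ^+ m != 0 by rewrite expf_neq0.
  set u := x ^+ m; set v := y ^+ m => v0 u0 vE.
  have -> : j a = (1 - u - v) / (u * v) by rewrite -[X in X - u - v]vE; field; rewrite u0 v0.
  by field; rewrite u0 v0.
pose o1 := x^-1 ^+ m.-1 * (y^-1 ^+ m + -1); pose o2 := - y^-1 ^+ m.-1.
have Oo1 : O o1.
  apply: OM; first exact: (valX O_val).
  by apply: OD; [exact: (valX O_val)|rewrite -[-1]invrN1].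
have Oo2 : O o2 by apply/(valN O_val)/(valX O_val).
have Oa : O (j a)^-1 by rewrite -fmorphV.
have oE : j a = x^-1 * o1 + y^-1 * o2.
  by rewrite aE /o1 /o2 -(prednK m0) !exprS /=; ring.
have a0 : j a != 0 by rewrite fmorph_eq0 (cs_a_neq0 S).
have [Oq|] := OV (x / y).
  apply: Ox'; have -> : x = (j a)^-1 * (o1 + x / y * o2).
    apply: (mulfI a0); rewrite mulVKf // [in LHS]oE; field; rewrite y0 x0 //.
  by apply: (OM _ _) => //; apply: (OD _ _) => //; apply: (OM _ _).
rewrite invfM invrK mulrC => Oq.
apply: Oy'; have -> : y = (j a)^-1 * (y / x * o1 + o2).
  apply: (mulfI a0); rewrite mulVKf // [in LHS]oE; field; rewrite y0 x0 //.
by apply: (OM _ _) => //; apply: (OD _ _) => //; apply: (OM _ _).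
Qed.

End RegularMonomials.

Section RegularAutomorphisms.
Variables (K : closedFieldType) (L : fieldType) (j : {rmorphism K -> L}).
Variables (x y : L) (a zeta : K) (m : nat).
Hypothesis S : curve_setting j x y a zeta m.
Notation fy := (cs_fy j x y a m).
Notation D := (der S).

(** The ratio of s omega to omega, where omega is the differential dual to D. *)
Definition der_factor (s : kaut j) := D (s x) / s fy.

Lemma der_kaut (s : kaut j) z : D (s z) = der_factor s * s (D z).
Proof.
have [DD DM Dj] := der_is_derivation S.
pose E w := D (s w) - der_factor s * s (D w).
have E_der : derivation_along j s E.
  split=> [u v|u v|c]; rewrite /E.
  - by rewrite DD !rmorphD DD; ring.
  - by rewrite DM !rmorphM DM /= rmorphD !rmorphM /=; ring.
  - by rewrite kautj Dj rmorph0 mulr0 subr0.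
apply/eqP; rewrite -subr_eq0; apply/eqP.
apply: (der_eq0 S (kautj s) E_der).
by rewrite /E der_x /der_factor divfK ?subrr // fmorph_eq0 (cs_fy_neq0 S).
Qed.

Lemma der_factor_neq0 (s : kaut j) : der_factor s != 0.
Proof.
apply/negP => /eqP c0; have := der_kaut s (s^-1%g x).
rewrite c0 mul0r kautVK der_x => /eqP.
by rewrite (negPf (cs_fy_neq0 S)).
Qed.

(** In terms of differentials: if g omega is regular then so is its image by s. *)
Lemma regular_der_kaut (s : kaut j) g : regular j D g -> regular j D (der_factor s * s g).
Proof. exact: (regular_kaut (der_kaut s)). Qed.

Lemma regular_der_kaut_inv (s : kaut j) g :
  regular j D g -> regular j D (s^-1%g (g / der_factor s)).
Proof.
move=> /(regular_der_kaut s^-1%g).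
set c := der_factor _; suff -> : c = s^-1%g (der_factor s)^-1.
  by rewrite mulrC -rmorphM.
have := der_kaut s (s^-1%g x); have := der_kaut s^-1%g x.
rewrite (kautVK s) -/c => -> /eqP; rewrite rmorphM /= kautVK der_x.
rewrite -{1}[fy]mul1r mulrA => /eqP/(mulIf (cs_fy_neq0 S)) cE.
rewrite -[c](kautK s); congr (s^-1%g _).
by apply: (mulfI (der_factor_neq0 s)); rewrite divff ?der_factor_neq0 // -cE.
Qed.

End RegularAutomorphisms.

(** * Local rings at the affine points *)

Lemma eval_idfun (K : fieldType) (x0 y0 : K) u :
  eval_at idfun x0 y0 u = u.[x0%:P].[y0].
Proof.
rewrite /eval_at; congr (_.[_].[_]).
by rewrite map_poly_id // => p _; rewrite map_poly_id.
Qed.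

Section LocalRing.
Variables (K : closedFieldType) (L : fieldType) (j : {rmorphism K -> L}).
Variables (x y : L) (a zeta : K) (m : nat) (x0 y0 : K).
Notation f := (curve_poly a m).
Notation ev := (eval_at j x y).
Notation evP := (eval_at idfun x0 y0).

Definition local_ring (z : L) : Prop :=
  exists u v, evP v != 0 /\ z * ev v = ev u.

Hypothesis S : curve_setting j x y a zeta m.
Hypothesis fP : a * x0 ^+ m * y0 ^+ m + x0 ^+ m + y0 ^+ m = 1.

Lemma eval_point_curve : evP f = 0.
Proof. by rewrite eval_at_curve /= fP subrr. Qed.

Lemma eval_point_eq u v : ev u = ev v -> evP u = evP v.
Proof.
apply: (eval_at_sub_eq0 (cs_function_field S) (e := evP)) => [u' v'|w].
  by rewrite eval_atB.
by rewrite eval_atM eval_point_curve mulr0.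
Qed.

Lemma eval_point_neq0 v : evP v != 0 -> ev v != 0.
Proof.
by apply: contraNneq => v0; rewrite -(eval_at0 idfun x0 y0); apply/eqP/eval_point_eq;
   rewrite v0 eval_at0.
Qed.

(** The Taylor formula at order one. *)
Lemma vanish_decomp (u : {poly {poly K}}) : evP u = 0 ->
  exists U V, u.[x0%:P] = V * ('X - y0%:P) /\
    u = U * ('X - x0%:P%:P) + V%:P * ('Y - y0%:P%:P).
Proof.
rewrite eval_idfun => /eqP; rewrite -/(root _ _) => /factor_theorem[V uV].
have /factor_theorem[U uU] : root (u - u.[x0%:P]%:P) x0%:P.
  by rewrite /root hornerD hornerN hornerC subrr.
exists U, V; split=> //; rewrite -uU -(rmorphB polyC) -rmorphM /= -uV.
by rewrite subrK.
Qed.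

Lemma smooth_au1 : a * x0 ^+ m + 1 != 0.
Proof.
apply/negP => /eqP au1.
have : (a * x0 ^+ m + 1) * y0 ^+ m + x0 ^+ m = 1 by rewrite -[RHS]fP; ring.
rewrite au1 mul0r add0r => u1; move: au1; rewrite u1 mulr1 => /eqP.
by rewrite (negPf (cs_a1_neq0 S)).
Qed.

(** When y0 != 0 the derivative f_y does not vanish at the point, so x - x0
    generates the maximal ideal of the local ring. *)
Lemma vanish_local u : y0 != 0 -> evP u = 0 ->
  exists u1 v1, evP v1 != 0 /\ ev u * ev v1 = (x - j x0) * ev u1.
Proof.
move=> y00 /vanish_decomp[U [V [_ uE]]].
have [Uf [Vf [fE' fE]]] := vanish_decomp eval_point_curve.
have VfP : evP Vf%:P != 0.
  rewrite eval_atC /= map_poly_id //.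
  have -> : Vf.[y0] = (f.[x0%:P])^`().[y0].
    rewrite fE' derivM derivXsubC !hornerE subrr; ring.
  rewrite curve_polyE !(hornerE, horner_exp) /=.
  rewrite -polyC_exp !(derivD, derivM, derivC, derivXn, hornerE, derivN).
  rewrite subr0 hornerMn hornerXn.
  have -> : a * (y0 ^+ m.-1 *+ m) * x0 ^+ m + y0 ^+ m.-1 *+ m =
      y0 ^+ m.-1 *+ m * (a * x0 ^+ m + 1) by ring.
  by rewrite -mulr_natr !mulf_neq0 ?expf_neq0 ?smooth_au1 ?(cs_mK_neq0 S).
have fev : ev f = 0 by apply/(cs_function_field S).1; exists 1; rewrite mul1r.
have evXY (A : {poly {poly K}}) (B : {poly K}) :
    ev (A * ('X - x0%:P%:P) + B%:P * ('Y - y0%:P%:P)) =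
    ev A * (x - j x0) + ev B%:P * (y - j y0).
  by rewrite eval_atD !eval_atM !eval_atB eval_atX eval_atY !eval_atCC.
exists (U * Vf%:P - V%:P * Uf), Vf%:P; split=> //.
move: fev; rewrite {1}fE uE !evXY eval_atB !eval_atM => /eqP.
rewrite addr_eq0 => /eqP fev.
have {}fev : ev Vf%:P * (y - j y0) = - (ev Uf * (x - j x0)) by rewrite fev opprK.
transitivity (ev U * (x - j x0) * ev Vf%:P + ev V%:P * (ev Vf%:P * (y - j y0))).
  by ring.
by rewrite fev; ring.
Qed.

Lemma x_sub_neq0 (c : K) : x - j c != 0.
Proof.
rewrite subr_eq0; have := cs_y_power_nonconstant (curve_setting_swap S) c (ltn0Sn 0) (oner_neq0 K).
by rewrite rmorph1 mul1r expr1.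
Qed.

(** Each nonzero function is a power of the uniformiser times a unit.  Dividing
    by the uniformiser terminates because it divides the norm of the function,
    a nonzero polynomial in x. *)
Lemma local_order u : y0 != 0 -> ev u != 0 ->
  exists k u1 v1, [/\ evP u1 != 0, evP v1 != 0 &
    ev u * ev v1 = (x - j x0) ^+ k * ev u1].
Proof.
move=> y00 u0; have t0 := x_sub_neq0 x0.
have main k : forall u w e, evP e != 0 ->
    ev u * ev w = (x - j x0) ^+ k * ev e ->
    exists k u1 v1, [/\ evP u1 != 0, evP v1 != 0 &
      ev u * ev v1 = (x - j x0) ^+ k * ev u1].
  (* The value of e at the point is nonzero; if u vanishes there, then it is
     divisible by x - x0, which lowers k. *)
  elim: k => [|k IHk] {u u0}u w e eP uwE.
    exists 0%N, u, 1; rewrite !eval_at1 mulrC; split; rewrite ?oner_eq0 //.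
    apply: contraNneq eP => uP; rewrite expr0 mul1r -eval_atM in uwE.
    by rewrite -(eval_point_eq uwE) eval_atM uP mul0r.
  have [uP|uP] := eqVneq (evP u) 0; last first.
    by exists 0%N, u, 1; rewrite !eval_at1 mulrC oner_eq0.
  have [u1 [v1 [v1P u1E]]] := vanish_local y00 uP.
  have [||k' [u2 [v2 [u2P v2P u2E]]]] := IHk u1 w (e * v1).
  - by rewrite eval_atM mulf_neq0.
  - apply: (mulfI t0); rewrite mulrA -u1E mulrAC uwE eval_atM exprS; ring.
  exists k'.+1, u2, (v1 * v2); split=> //; first by rewrite eval_atM mulf_neq0.
  by rewrite eval_atM mulrA u1E -mulrA u2E exprS mulrA.
have S' := curve_setting_swap S.
have := norm_exists (cs_m_gt0 S) (cs_a_neq0 S) (cs_function_field S') (u := swapXY u).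
rewrite eval_at_swap => /(_ u0)[v [c [c0 uvE]]].
have [k [e]] := multiplicity_XsubC c x0.
rewrite c0 => /= ex0 cE.
apply: (main k u (swapXY v) (map_poly polyC e)).
  by rewrite eval_at_poly /= map_poly_id.
rewrite eval_at_swap uvE eval_at_poly cE mulrC rmorphM rmorphXn /= rmorphB /=.
by rewrite map_polyX map_polyC !(hornerE, horner_exp).
Qed.

Lemma local_ring_frac u v : evP v != 0 -> local_ring (ev u / ev v).
Proof. by move=> vP; exists u, v; rewrite divfK // eval_point_neq0. Qed.

Lemma local_ring_total z : y0 != 0 -> local_ring z \/ local_ring z^-1.
Proof.
move=> y00; have [-> | z0] := eqVneq z 0.
  by left; exists 0, 1; rewrite mul0r eval_at0 eval_at1 oner_eq0.
have t0 := x_sub_neq0 x0.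
have [u [v [v0 zE]]] := (cs_function_field S).2 z.
have u0 : ev u != 0 by apply: contraNneq z0 => u0; rewrite zE u0 mul0r.
have [k [u1 [u2 [u1P u2P uE]]]] := local_order y00 u0.
have [l [v1 [v2 [v1P v2P vE]]]] := local_order y00 v0.
have [u10 u20] := (eval_point_neq0 u1P, eval_point_neq0 u2P).
have [v10 v20] := (eval_point_neq0 v1P, eval_point_neq0 v2P).
have uE' : ev u = (x - j x0) ^+ k * ev u1 / ev u2 by rewrite -uE mulfK.
have vE' : ev v = (x - j x0) ^+ l * ev v1 / ev v2 by rewrite -vE mulfK.
have evt r : ev (('X - x0%:P%:P) ^+ r) = (x - j x0) ^+ r.
  by rewrite eval_atXn eval_atB eval_atX eval_atCC.
have [kl|/ltnW kl] := leqP l k; [left|right].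
  have -> : z = ev (('X - x0%:P%:P) ^+ (k - l) * u1 * v2) / ev (u2 * v1).
    rewrite zE uE' vE' -{1}(subnK kl) exprD !eval_atM evt.
    by field; rewrite u20 v20 v10 expf_neq0.
  by apply: local_ring_frac; rewrite eval_atM mulf_neq0.
have -> : z^-1 = ev (('X - x0%:P%:P) ^+ (l - k) * v1 * u2) / ev (v2 * u1).
  rewrite zE invf_div uE' vE' -{1}(subnK kl) exprD !eval_atM evt.
  by field; rewrite u20 v20 u10 expf_neq0.
by apply: local_ring_frac; rewrite eval_atM mulf_neq0.
Qed.

End LocalRing.

Lemma local_ring_swap (K : closedFieldType) (L : fieldType)
    (j : {rmorphism K -> L}) (x y : L) (x0 y0 : K) z :
  local_ring j x y x0 y0 z -> local_ring j y x y0 x0 z.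
Proof.
by move=> [u [v [vP zE]]]; exists (swapXY u), (swapXY v); rewrite !eval_at_swap.
Qed.

Section RegularLocal.
Variables (K : closedFieldType) (L : fieldType) (j : {rmorphism K -> L}).
Variables (x y : L) (a zeta : K) (m : nat) (x0 y0 : K).
Notation ev := (eval_at j x y).
Hypothesis S : curve_setting j x y a zeta m.
Hypothesis fP : a * x0 ^+ m * y0 ^+ m + x0 ^+ m + y0 ^+ m = 1.

Lemma local_ring_valuation : valuation_subring j (local_ring j x y x0 y0).
Proof.
split=> [c|z w|z w|z].
- by exists c%:P%:P, 1; rewrite !eval_at1 mulr1 eval_atCC oner_eq0.
- move=> [u [v [vP zE]]] [u' [v' [v'P wE]]]; exists (u * v' + u' * v), (v * v').
  by rewrite eval_atD !eval_atM mulf_neq0 // -zE -wE; split=> //; ring.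
- move=> [u [v [vP zE]]] [u' [v' [v'P wE]]]; exists (u * u'), (v * v').
  by rewrite !eval_atM mulf_neq0 // -zE -wE; split=> //; ring.
have [y00|y00] := eqVneq y0 0; last exact: (local_ring_total S fP).
have x00 : x0 != 0.
  have := fP; rewrite y00; apply: contra_eqN => /eqP ->.
  rewrite expr0n; case: (m) (cs_m_gt0 S) => //= k _.
  by rewrite !(mulr0, addr0) eq_sym oner_neq0.
have fP' : a * y0 ^+ m * x0 ^+ m + y0 ^+ m + x0 ^+ m = 1 by rewrite -[RHS]fP; ring.
have [zl|zl] := local_ring_total (curve_setting_swap S) fP' z x00.
  by left; apply: local_ring_swap zl.
by right; apply: local_ring_swap zl.
Qed.

(** The derivation D maps K[x, y], hence its localisations, to itself; so
    O D(O) is contained in O when O is the local ring of an affine point. *)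
Lemma regular_local_ring g : regular j (der S) g -> local_ring j x y x0 y0 g.
Proof.
have OV := local_ring_valuation.
move=> /(_ _ OV)[o [z [Oo [u [v [vP zE]]] ->]]].
have [_ _ OM _] := OV; apply: OM => //.
have v0 := eval_point_neq0 S fP vP.
have -> : z = ev u / ev v by rewrite -zE mulfK.
rewrite der_frac // -!eval_atM -eval_atB -eval_atXn.
by apply: (local_ring_frac S fP); rewrite eval_atXn expf_neq0.
Qed.

End RegularLocal.

(** * Explicit automorphisms *)

Section Automorphisms.
Variables (K : closedFieldType) (L : fieldType) (j : {rmorphism K -> L}).
Variables (x y : L) (a zeta : K) (m : nat).
Hypothesis S : curve_setting j x y a zeta m.
Let S' := curve_setting_swap S.

(** As K is algebraically closed, an element of L that is algebraic over K lies
    in K. *)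
Lemma transcendental_notin (t : L) : (forall c, t != j c) -> transcendental j t.
Proof.
move=> tj c c0; have [r ->] := closed_field_poly_normal c.
rewrite -mul_polyC rmorphM /= map_polyC hornerM hornerC mulf_neq0 //.
  by rewrite fmorph_eq0 lead_coef_eq0.
rewrite rmorph_prod horner_prod; elim/big_ind: _ => [||i _ /=].
- exact: oner_neq0.
- by move=> u v u0 v0; rewrite mulf_neq0.
by rewrite rmorphB /= map_polyX map_polyC !hornerE subr_eq0 tj.
Qed.

Lemma scaled_notin (d e : K) : d != 0 -> j d * y != j e.
Proof. by move=> d0; have := cs_y_power_nonconstant S e (ltn0Sn 0) d0; rewrite expr1. Qed.

Lemma kaut_of_point (x1 y1 : L) :
  j a * x1 ^+ m * y1 ^+ m + x1 ^+ m + y1 ^+ m = 1 -> (forall c, y1 != j c) ->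
  (forall g : {rmorphism L -> L}, (forall c, g (j c) = j c) -> g x = x1 ->
     g y = y1 -> exists px py, g px = x /\ g py = y) ->
  exists s : kaut j, s x = x1 /\ s y = y1.
Proof.
move=> e1 y1j; apply: (kaut_exists (cs_m_gt0 S) (cs_a_neq0 S) (cs_function_field S)).
  by rewrite eval_at_curve e1 subrr.
exact: transcendental_notin.
Qed.

Lemma torus_exists (c d : K) : c ^+ m = 1 -> d ^+ m = 1 ->
  exists s : kaut j, s x = j c * x /\ s y = j d * y.
Proof.
move=> cm dm.
have nz (e : K) : e ^+ m = 1 -> e != 0 by apply: (unity_root_neq0 S).
apply: kaut_of_point => [|e|g gj gx gy].
- by rewrite !exprMn -!rmorphXn cm dm rmorph1 !mul1r (cs_curve_eq S).
- exact/scaled_notin/nz.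
exists (j c^-1 * x), (j d^-1 * y); rewrite !rmorphM !gj gx gy !mulrA -!rmorphM.
by rewrite !mulVf ?nz // rmorph1 !mul1r.
Qed.

Lemma inversion_exists (b : K) : b ^+ m = - a^-1 ->
  exists s : kaut j, s x = j b / x /\ s y = j b / y.
Proof.
move=> bm; have a0 := cs_a_neq0 S.
have b0 : b != 0.
  apply: contra_eq_neq bm => ->.
  by rewrite expr0n gtn_eqF ?(cs_m_gt0 S) // eq_sym oppr_eq0 invr_eq0.
have x0 := cs_y_neq0 S'; have y0 := cs_y_neq0 S.
have ja0 : j a != 0 by rewrite fmorph_eq0.
have jb0 : j b != 0 by rewrite fmorph_eq0.
apply: kaut_of_point => [|e|g gj gx gy].
- rewrite !exprMn !exprVn -!rmorphXn bm rmorphN fmorphV.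
  have u0 : x ^+ m != 0 by rewrite expf_neq0.
  have v0 : y ^+ m != 0 by rewrite expf_neq0.
  have vE := cs_curve_eq S.
  move: u0 v0 vE; set u := x ^+ m; set v := y ^+ m => u0 v0 vE.
  transitivity ((1 - u - v) / (j a * u * v)); first by field; rewrite u0 v0 ja0.
  have -> : 1 - u - v = j a * u * v by rewrite -[X in X - u - v]vE; ring.
  by rewrite divff // !mulf_neq0.
- apply/negP => /eqP E; have [e0|e0] := eqVneq e 0.
    move/eqP: E; rewrite e0 rmorph0 mulf_eq0 invr_eq0.
    by rewrite (negPf jb0) (negPf y0).
  have := scaled_notin b e0; rewrite -E.
  by rewrite divfK // eqxx.
exists (j b / x), (j b / y); rewrite !fmorph_div !gj gx gy.
by split; field; rewrite ?jb0 ?x0 ?y0.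
Qed.

Lemma swap_exists : exists s : kaut j, s x = y /\ s y = x.
Proof.
apply: kaut_of_point => [|e|g gj gx gy]; last by exists y, x.
- by rewrite (cs_curve_eq S').
- by have := cs_y_power_nonconstant S' e (ltn0Sn 0) (oner_neq0 K); rewrite rmorph1 mul1r expr1.
Qed.

Lemma flip_exists (eps : K) : a = 1 -> eps ^+ m = -1 ->
  exists s : kaut j, s x = j eps * x /\ s y = y^-1.
Proof.
move=> a1 em.
have x0 := cs_y_neq0 S'; have y0 := cs_y_neq0 S.
have e0 : j eps != 0.
  rewrite fmorph_eq0; apply: contra_eq_neq em => ->.
  by rewrite expr0n gtn_eqF ?(cs_m_gt0 S) // eq_sym oppr_eq0 oner_neq0.
apply: kaut_of_point => [|e|g gj gx gy].
- rewrite !exprMn !exprVn -!rmorphXn em a1 rmorphN rmorph1.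
  have v0 : y ^+ m != 0 by rewrite expf_neq0.
  have := cs_curve_eq S; rewrite a1 rmorph1.
  move: v0; set u := x ^+ m; set v := y ^+ m => v0 vE.
  transitivity ((1 - u - u * v) / v); first by field.
  have -> : 1 - u - u * v = v by rewrite -[X in X - u - _]vE; ring.
  by rewrite divff.
- apply/negP => /eqP E; have [ee0|ee0] := eqVneq e 0.
    by move/eqP: E; rewrite ee0 rmorph0 invr_eq0 (negPf y0).
  by have := scaled_notin 1 ee0; rewrite -E mulVf // rmorph1 eqxx.
exists (x / j eps), y^-1; rewrite fmorph_div fmorphV !gj gx gy invrK.
by split=> //; rewrite mulrAC divff // mul1r.
Qed.

End Automorphisms.

(** * The field fixed by a rotation *)

Section ReversedPoly.
Variables (K : fieldType) (b : K) (d : nat).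

(** The polynomial t^d N(b/t), for d at least the degree of N. *)
Definition inv_poly (N : {poly K}) : {poly K} :=
  \sum_(i < d.+1) (N`_i * b ^+ i) *: 'X^(d - i).

Lemma horner_inv_poly (L : fieldType) (j : {rmorphism K -> L})
    (N : {poly K}) (t : L) :
  t != 0 -> (size N <= d.+1)%N ->
  (map_poly j (inv_poly N)).[t] = t ^+ d * (map_poly j N).[j b / t].
Proof.
move=> t0 sN; rewrite [in RHS](@horner_coef_wide _ d.+1) ?size_map_poly // mulr_sumr.
rewrite rmorph_sum horner_sum; apply: eq_bigr => i _ /=.
rewrite map_polyZ map_polyXn hornerZ hornerXn coef_map /= rmorphM rmorphXn.
have id : (i <= d)%N by rewrite -ltnS.
have -> : t ^+ d = t ^+ (d - i) * t ^+ i by rewrite -exprD subnK.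
rewrite exprMn exprVn.
by field; rewrite expf_neq0.
Qed.

Lemma horner_inv_poly_id (N : {poly K}) t :
  t != 0 -> (size N <= d.+1)%N -> (inv_poly N).[t] = t ^+ d * N.[b / t].
Proof. by move=> t0 /(horner_inv_poly idfun t0); rewrite !map_poly_id. Qed.

Lemma horner_inv_poly0 (N : {poly K}) : (inv_poly N).[0] = N`_d * b ^+ d.
Proof.
rewrite horner_sum (bigD1 ord_max) //= hornerZ hornerXn subnn expr0 mulr1.
rewrite big1 ?addr0 // => i ni.
rewrite hornerZ hornerXn expr0n subn_eq0 [(d <= i)%N](negbTE _) ?mulr0 //.
rewrite -ltnNge ltn_neqAle -ltnS ltn_ord andbT.
by apply: contra ni => /eqP ni; apply/eqP/val_inj.
Qed.

End ReversedPoly.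

Lemma sum_prim_root (K : fieldType) (zeta : K) m i : m.-primitive_root zeta ->
  \sum_(k < m) zeta ^+ (k * i) = if (m %| i)%N then m%:R else 0.
Proof.
move=> zP; have [mi|mi] := boolP (m %| i)%N.
  rewrite (eq_bigr (fun=> 1)) ?sumr_const ?card_ord // => k _.
  by apply/eqP; rewrite -(prim_order_dvd zP) dvdn_mull.
have z1 : zeta ^+ i - 1 != 0 by rewrite subr_eq0 -(prim_order_dvd zP).
apply: (mulfI z1); rewrite mulr0.
rewrite (eq_bigr (fun k : 'I_m => (zeta ^+ i) ^+ k)) => [|k _].
  by rewrite -subrX1 -exprM mulnC exprM (prim_expr_order zP) expr1n subrr.
by rewrite mulnC exprM.
Qed.

Section FixedField.
Variables (K : closedFieldType) (L : fieldType) (j : {rmorphism K -> L}).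
Variables (x y : L) (a zeta : K) (m : nat).
Hypothesis S : curve_setting j x y a zeta m.
Let S' := curve_setting_swap S.
Notation ev := (eval_at j x y).
Variables (g : kaut j).
Hypotheses (gx : g x = x) (gy : g y = j zeta * y).

Lemma iter_eval k u : iter k g (ev u) = eval_at j x (j zeta ^+ k * y) u.
Proof.
elim: k => [|k IHk] /=; first by rewrite expr0 mul1r.
by rewrite IHk kaut_eval gx rmorphM rmorphXn /= kautj gy mulrA exprSr.
Qed.

Lemma eval_at_coefY u t :
  eval_at j x t u = \sum_(i < size (swapXY u)) (map_poly j (swapXY u)`_i).[x] * t ^+ i.
Proof.
rewrite -eval_at_swap /eval_at [X in X.[x] = _]horner_coef horner_sum.
have sE : size (map_poly (map_poly j) (swapXY u)) = size (swapXY u).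
  by rewrite size_map_inj_poly ?rmorph0 //; apply: map_poly_inj.
rewrite sE; apply: eq_bigr => i _.
by rewrite hornerM -polyC_exp hornerC coef_map.
Qed.

(** The rotation multiplies y^i by zeta^i, so averaging over its powers leaves
    the powers of y^m, which is a fraction in x. *)
Lemma rotation_fixed_field z : g z = z ->
  exists N M : {poly K}, M != 0 /\ z * (map_poly j M).[x] = (map_poly j N).[x].
Proof.
move=> gz; have zE := num_denE (cs_function_field S) z.
have v0 := den_neq0 (cs_function_field S) z.
move: zE v0; set u := num _ z; set v := den _ z => zE v0.
have := norm_exists (cs_m_gt0 S) (cs_a_neq0 S) (cs_function_field S') (u := swapXY v).
rewrite eval_at_swap => /(_ v0)[w [M [M0 vwE]]].
pose A := u * swapXY w.
have zA : z * (map_poly j M).[x] = ev A.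
  by rewrite -vwE [in LHS]zE mulrA divfK // eval_atM eval_at_swap.
have fixA k : iter k g (ev A) = ev A.
  elim: k => //= k ->; rewrite -zA rmorphM /= gz -(eval_at_poly j x y).
  by rewrite kaut_eval gx !eval_at_poly.
have sumA : m%:R * ev A = \sum_(k < m) iter k g (ev A).
  by rewrite (eq_bigr (fun=> ev A)) // sumr_const card_ord mulr_natl.
set B := swapXY A in sumA *; set e := size B.
have vE := cs_kummer_eq S.
(* Powers of y^m are cleared by the common denominator (a x^m + 1)^e. *)
exists (\sum_(i < e | (m %| i)%N)
   B`_i * (1 - 'X^m) ^+ (i %/ m) * (a *: 'X^m + 1) ^+ (e - i %/ m)).
exists (M * (a *: 'X^m + 1) ^+ e); split.
  rewrite mulf_neq0 ?expf_neq0 //.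
  have := cs_a1_neq0 S; apply: contra_neq => /(congr1 (fun p => p.[1])).
  by rewrite !hornerE expr1n mulr1.
have au1E : (map_poly j (a *: 'X^m + 1)).[x] = j a * x ^+ m + 1.
  by rewrite rmorphD rmorph1 /= map_polyZ map_polyXn hornerD hornerZ hornerXn hornerC.
have u1E : (map_poly j (1 - 'X^m)).[x] = 1 - x ^+ m.
  by rewrite rmorphB rmorph1 /= map_polyXn hornerD hornerN hornerXn hornerC.
rewrite rmorphM rmorphXn hornerM horner_exp au1E mulrA zA.
apply: (mulfI (cs_m_neq0 S)); rewrite mulrA sumA.
under eq_bigr do rewrite iter_eval eval_at_coefY -/B -/e.
rewrite exchange_big /= mulr_suml rmorph_sum horner_sum mulr_sumr [RHS]big_mkcond /=.
apply: eq_bigr => i _; rewrite -mulr_sumr.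
under eq_bigr do rewrite exprMn -exprM.
rewrite -mulr_suml.
have -> : \sum_(k < m) j zeta ^+ (k * i) = if (m %| i)%N then m%:R else 0.
  have := congr1 j (sum_prim_root i (cs_zeta_prim S)).
  rewrite rmorph_sum (fun_if j) rmorph_nat rmorph0 => <-.
  by apply: eq_bigr => k _; rewrite rmorphXn.
case: ifP => [mi|_]; last by rewrite mul0r mulr0 mul0r.
rewrite !rmorphM !rmorphXn !hornerM !horner_exp au1E u1E -vE exprMn -exprM.
have ie : (i %/ m <= e)%N by apply: leq_trans (leq_div _ _) (ltnW (ltn_ord i)).
set P := j a * x ^+ m + 1.
have -> : P ^+ e = P ^+ (e - i %/ m) * P ^+ (i %/ m) by rewrite -exprD subnK.
have alg (q n yi p1 p2 : L) : q * (n * yi) * (p1 * p2) = n * (q * (yi * p2) * p1).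
  by ring.
by rewrite mulnC divnK //; apply: alg.
Qed.
End FixedField.

(** * Regular eigenvectors of a rotation *)

Lemma root_exists (K : closedFieldType) (c : K) m : (0 < m)%N ->
  exists d, d ^+ m = c.
Proof.
move=> m0; have /closed_rootP[d] : size ('X^m - c%:P : {poly K}) != 1.
  by rewrite size_XnsubC // eqSS -lt0n.
by rewrite /root !hornerE subr_eq0 => /eqP; exists d.
Qed.

Lemma unity_root_cofactor (K : fieldType) (x0 : K) m :
  m%:R != 0 :> K -> (0 < m)%N -> x0 ^+ m = 1 ->
  exists E : {poly K}, E.[x0] != 0 /\ 'X^m - 1 = E * ('X - x0%:P).
Proof.
move=> mn0 m0 xm; have /factor_theorem[E EE] : root ('X^m - 1) x0.
  by rewrite /root !hornerE xm subrr.
exists E; split=> //.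
have -> : E.[x0] = ('X^m - 1 : {poly K})^`().[x0].
  by rewrite EE derivM derivXsubC !hornerE subrr mulr0 add0r.
rewrite derivB derivXn derivC subr0 hornerMn hornerXn -mulr_natr mulf_neq0 //.
rewrite expf_neq0 //; apply: contra_eq_neq xm => ->.
by rewrite expr0n gtn_eqF // eq_sym oner_neq0.
Qed.

Section RegularEigenvectors.
Variables (K : closedFieldType) (L : fieldType) (j : {rmorphism K -> L}).
Variables (x y : L) (a zeta : K) (m : nat).
Hypothesis S : curve_setting j x y a zeta m.
Notation ev := (eval_at j x y).
Notation D := (der S).
Notation px N := (map_poly polyC N : {poly {poly K}}).

(** Evaluation at the point settles the case y0 != 0.  When y0 = 0 the function
    y is a uniformiser and x - x0 vanishes to order m > l there, so that y^l
    cannot compensate a zero of M. *)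
Lemma no_pole (x0 y0 : K) l (N M : {poly K}) A B :
  a * x0 ^+ m * y0 ^+ m + x0 ^+ m + y0 ^+ m = 1 -> (l < m)%N ->
  eval_at idfun x0 y0 B != 0 -> M.[x0] = 0 ->
  (map_poly j N).[x] * y ^+ l * ev B = ev A * (map_poly j M).[x] ->
  N.[x0] = 0.
Proof.
move=> fP lm BP Mx0 E; apply/eqP/negPn/negP => N0.
have evPx (P : {poly K}) : eval_at idfun x0 y0 (px P) = P.[x0].
  by rewrite eval_at_poly map_poly_id.
have [y00|y00] := eqVneq y0 0; last first.
  have : ev (px N * 'Y ^+ l * B) = ev (A * px M).
    by rewrite !eval_atM eval_atXn eval_atY !eval_at_poly.
  move/(eval_point_eq S fP); rewrite !eval_atM eval_atXn eval_atY !evPx Mx0 mulr0 => /eqP.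
  by rewrite !mulf_eq0 (negPf N0) (negPf BP) expf_eq0 (negPf y00) andbF.
have xm : x0 ^+ m = 1.
  by rewrite -[RHS]fP y00 expr0n gtn_eqF ?(cs_m_gt0 S) // mulr0 add0r addr0.
have [T [T0 TE]] := unity_root_cofactor (cs_mK_neq0 S) (cs_m_gt0 S) xm.
have /factor_theorem[M1 M1E] : root M x0 by apply/rootP.
have yl0 : y ^+ l != 0 by rewrite expf_neq0 ?(cs_y_neq0 S).
have TEx : (map_poly j T).[x] * (x - j x0) = - (y ^+ m * (j a * x ^+ m + 1)).
  have := congr1 (fun p => (map_poly j p).[x]) TE.
  rewrite !(rmorphM, rmorphB, rmorphXn) /= rmorph1 map_polyX map_polyC.
  rewrite !(hornerE, horner_exp) /= => <-.
  by rewrite -[X in _ - X](cs_curve_eq S); ring.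
have : ev (px N * B * px T) =
    ev (- (A * px M1 * 'Y ^+ (m - l) * (a%:P%:P * 'X ^+ m + 1))).
  rewrite eval_atN !eval_atM !eval_atXn eval_atD eval_atM eval_atXn.
  rewrite eval_atY eval_atX eval_at1 eval_atCC !eval_at_poly.
  apply: (mulIf yl0).
  transitivity ((map_poly j N).[x] * y ^+ l * ev B * (map_poly j T).[x]).
    by ring.
  have M1Ex : (map_poly j M).[x] = (map_poly j M1).[x] * (x - j x0).
    by rewrite M1E rmorphM rmorphB /= map_polyX map_polyC !hornerE.
  rewrite E M1Ex.
  transitivity (ev A * (map_poly j M1).[x] * ((map_poly j T).[x] * (x - j x0))).
    by ring.
  by rewrite TEx -{1}(subnK (ltnW lm)) exprD; ring.
move/(eval_point_eq S fP).
have yml : y0 ^+ (m - l) = 0 by rewrite y00 expr0n gtn_eqF ?subn_gt0.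
rewrite !eval_atM !evPx eval_atN !eval_atM eval_atXn eval_atY yml.
rewrite mulr0 mul0r oppr0 => /eqP.
by rewrite !mulf_eq0 (negPf N0) (negPf T0) (negPf BP).
Qed.

Section Inversion.
Variables (b : K) (s0 : kaut j).
Hypotheses (bm : b ^+ m = - a^-1) (s0x : s0 x = j b / x) (s0y : s0 y = j b / y).

Lemma inversion_base_neq0 : b != 0.
Proof.
apply: contra_eq_neq bm => ->; rewrite expr0n gtn_eqF ?(cs_m_gt0 S) //.
by rewrite eq_sym oppr_eq0 invr_eq0 (cs_a_neq0 S).
Qed.

Lemma der_factor_inversion :
  der_factor S s0 = (x * y) ^+ m.-2 / j b ^+ m.-2.
Proof.
have S' := curve_setting_swap S; have D_der := der_is_derivation S.
have b0 := inversion_base_neq0; have jb0 : j b != 0 by rewrite fmorph_eq0.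
have ja0 : j a != 0 by rewrite fmorph_eq0 (cs_a_neq0 S).
have x0 := cs_y_neq0 S'; have y0 := cs_y_neq0 S; have m0 := cs_m_neq0 S.
have DE : D (s0 x) = - (j b * x^-1 ^+ 2 * cs_fy j x y a m).
  have [_ DM Dj] := D_der.
  by rewrite s0x DM Dj mul0r addr0 /= (der_inv D_der S) der_x; ring.
have s0fy : s0 (cs_fy j x y a m) =
    m%:R * (j b / y) ^+ m.-1 * (j a * (j b / x) ^+ m + 1).
  rewrite /cs_fy !(rmorphM, rmorphD, rmorphXn, rmorph_nat, rmorph1) /=.
  by rewrite s0x s0y kautj.
rewrite /der_factor DE s0fy /cs_fy [(j b / x) ^+ m]exprMn -(rmorphXn j m b) bm.
rewrite rmorphN fmorphV exprVn.
have vE := cs_curve_eq S.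
have u10 : 1 - x ^+ m != 0.
  rewrite subr_eq0 eq_sym -(rmorph1 j) -[x ^+ m]mul1r -{1}(rmorph1 j).
  exact: (cs_y_power_nonconstant S' 1 (cs_m_gt0 S) (oner_neq0 K)).
have u0 : x ^+ m != 0 by rewrite expf_neq0.
have v0 : y ^+ m != 0 by rewrite expf_neq0.
have auE : j a * x ^+ m + 1 = (1 - x ^+ m) / y ^+ m.
  apply: (mulIf v0); rewrite divfK //.
  by rewrite -[X in X - _]vE; ring.
rewrite auE.
have [n mE] : exists n, m = n.+2.
  by have := cs_m_gt2 S; case: (m) => [|[|k]] // _; exists k.
move: u10 u0 v0 m0; rewrite mE /=; move: (n.+2%:R : L) => M.
rewrite !exprMn !exprVn !exprS expr0.
move: (expf_neq0 n x0) (expf_neq0 n y0) (expf_neq0 n jb0).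
move: (x ^+ n) (y ^+ n) (j b ^+ n) => X Y B X0 Y0 B0 u10 u0 v0 M0.
have u11 : -1 + x * (x * X) != 0 by rewrite addrC -opprB oppr_eq0.
by field; rewrite B0 Y0 X0 jb0 y0 x0 M0 ja0 u11.
Qed.

Lemma regular_inversion (x1 y1 : K) g :
  a * x1 ^+ m * y1 ^+ m + x1 ^+ m + y1 ^+ m = 1 -> regular j D g ->
  local_ring j x y x1 y1 (der_factor S s0 * s0 g).
Proof. by move=> fP /(regular_der_kaut s0); apply: regular_local_ring. Qed.

(** The behaviour of a regular g = N(x)/M(x) y^l at the points at infinity,
    expressed at affine points through the inversion.  The two sides are
    multiplied by y so that the exponent m - 1 - l is nonnegative. *)
Lemma regular_at_inverse (x1 y1 : K) d l (N M : {poly K}) g :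
  a * x1 ^+ m * y1 ^+ m + x1 ^+ m + y1 ^+ m = 1 -> regular j D g -> (l < m)%N ->
  (size N <= d.+1)%N -> (size M <= d.+1)%N ->
  g * (map_poly j M).[x] = (map_poly j N).[x] * y ^+ l ->
  exists (A B : {poly {poly K}}) (c : K), [/\ c != 0, eval_at idfun x1 y1 B != 0 &
   (map_poly j (c *: 'X^(m.-2) * inv_poly b d N)).[x] * y ^+ (m.-1 - l) * ev B =
   ev (A * 'Y) * (map_poly j (inv_poly b d M)).[x]].
Proof.
move=> fP Rg lm sN sM gE.
have [A [B [BP AB]]] := regular_inversion fP Rg.
have S' := curve_setting_swap S.
have b0 := inversion_base_neq0; have jb0 : j b != 0 by rewrite fmorph_eq0.
have x0 := cs_y_neq0 S'; have y0 := cs_y_neq0 S.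
exists A, B, (b ^+ l / b ^+ m.-2); split=> //.
  by rewrite mulf_neq0 ?invr_eq0 ?expf_neq0.
have s0p (P : {poly K}) : s0 (map_poly j P).[x] = (map_poly j P).[j b / x].
  by rewrite -(eval_at_poly j x y) kaut_eval eval_at_poly s0x.
have s0gE : s0 g * (map_poly j M).[j b / x] =
    (map_poly j N).[j b / x] * (j b / y) ^+ l.
  by rewrite -!s0p -s0y -rmorphXn -!rmorphM gE.
rewrite eval_atM eval_atY -AB der_factor_inversion.
rewrite rmorphM /= map_polyZ map_polyXn hornerM hornerZ hornerXn /=.
rewrite !(horner_inv_poly _ _ x0) // fmorph_div !rmorphXn /=.
have -> : (x * y) ^+ m.-2 / j b ^+ m.-2 * s0 g * ev B * y *
    (x ^+ d * (map_poly j M).[j b / x]) =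
   (x * y) ^+ m.-2 / j b ^+ m.-2 * (s0 g * (map_poly j M).[j b / x]) *
     ev B * y * x ^+ d by ring.
rewrite s0gE !exprMn exprVn.
have ym : y ^+ m.-2 * y = y ^+ (m.-1 - l) * y ^+ l.
  have lm1 : (l <= m.-1)%N by rewrite -ltnS (prednK (cs_m_gt0 S)).
  rewrite -exprSr -exprD (subnK lm1).
  by case: (m) (cs_m_gt2 S) => [|[|k]].
have yl0 : y ^+ l != 0 by rewrite expf_neq0.
have bn0 : j b ^+ m.-2 != 0 by rewrite expf_neq0.
transitivity (x ^+ m.-2 / j b ^+ m.-2 * (map_poly j N).[j b / x] * j b ^+ l
  / y ^+ l * ev B * x ^+ d * (y ^+ m.-2 * y)); last by ring.
by rewrite ym; field; rewrite bn0 yl0.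
Qed.

End Inversion.

(** Write g = c(x) y^l.  The points with x finite show that c is a polynomial,
    the points with x infinite bound its degree by m - 2, and for l = m - 1 the m
    abscissas of the points with y infinite are zeros of c. *)
Lemma regular_eigen_poly l (N M : {poly K}) g :
  regular j D g -> (l < m)%N -> M != 0 ->
  g * (map_poly j M).[x] = (map_poly j N).[x] * y ^+ l ->
  exists P : {poly K}, [/\ (size P <= m.-1)%N,
    g = (map_poly j P).[x] * y ^+ l & l = m.-1 -> P = 0].
Proof.
have S' := curve_setting_swap S.
have [b bm] := root_exists (- a^-1) (cs_m_gt0 S).
have [s0 [s0x s0y]] := inversion_exists S bm.
have b0 := inversion_base_neq0 bm.
move=> Rg lm M0 gE.
have Mx0 : (map_poly j M).[x] != 0 by apply: (cs_transcendentalY S').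
have [N0|N0] := eqVneq N 0.
  exists 0; rewrite size_poly0 rmorph0 horner0 mul0r; split=> //.
  apply: (mulIf Mx0); rewrite gE N0 rmorph0 horner0 !mul0r.
  by [].
wlog NM : N M M0 N0 gE Mx0 / coprimep N M.
  move=> H; pose G := gcdp N M.
  have G0 : G != 0 by rewrite gcdp_eq0 negb_and N0.
  have NE : N = N %/ G * G by rewrite divpK // dvdp_gcdl.
  have ME : M = M %/ G * G by rewrite divpK // dvdp_gcdr.
  have Gx0 : (map_poly j G).[x] != 0 by apply: (cs_transcendentalY S').
  apply: (H (N %/ G) (M %/ G)).
  - by apply: contra_neq M0 => E; rewrite ME E mul0r.
  - by apply: contra_neq N0 => E; rewrite NE E mul0r.
  - apply: (mulIf Gx0); rewrite -mulrA -hornerM -rmorphM -ME gE [in LHS]NE.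
    by rewrite rmorphM hornerM mulrAC.
  - by apply: contra_neq Mx0 => E; rewrite ME rmorphM hornerM E mul0r.
  - by rewrite coprimep_div_gcd // N0.
(* From here on N / M is in lowest terms. *)
have rootNM z : M.[z] = 0 -> N.[z] != 0.
  by move=> Mz; move: NM; rewrite coprimep_sym => /coprimep_root; apply; apply/rootP.
have z_inv z : a * z ^+ m + 1 = 0 -> z != 0 /\ (b / z) ^+ m = 1.
  move=> az; have z0 : z != 0.
    apply: contra_eq_neq az => ->.
    by rewrite expr0n gtn_eqF ?(cs_m_gt0 S) // mulr0 add0r oner_neq0.
  split=> //; have a0 := cs_a_neq0 S.
  have zm : z ^+ m = - a^-1.
    by apply: (mulfI a0); rewrite mulrN divff //; apply/eqP; rewrite -addr_eq0 az.
  by rewrite exprMn exprVn bm zm divff // oppr_eq0 invr_eq0.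
have fP0 z1 : z1 ^+ m = 1 -> a * z1 ^+ m * 0 ^+ m + z1 ^+ m + 0 ^+ m = 1 :> K.
  by move=> ->; rewrite expr0n gtn_eqF ?(cs_m_gt0 S) // mulr0 add0r addr0.
have sM : size M = 1%N.
  apply/eqP/negPn/negP => /closed_rootP[z /rootP Mz].
  have Nz := rootNM z Mz; case/negP: Nz; apply/eqP.
  have [az|az] := eqVneq (a * z ^+ m + 1) 0.
    have [z0 z1m] := z_inv z az; set d := maxn (size N) (size M).
    have sN' : (size N <= d.+1)%N by rewrite leqW // leq_maxl.
    have sM' : (size M <= d.+1)%N by rewrite leqW // leq_maxr.
    have [A [B [c [c0 BP E]]]] :=
      regular_at_inverse bm s0x s0y (fP0 _ z1m) Rg lm sN' sM' gE.
    have z10 : b / z != 0 by rewrite mulf_neq0 ?invr_eq0.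
    have bbz : b / (b / z) = z by rewrite invf_div mulrC divfK.
    have := no_pole (fP0 _ z1m) _ BP _ E.
    rewrite hornerM hornerZ hornerXn !horner_inv_poly_id // bbz Mz mulr0.
    move=> /(_ _ erefl) /eqP; rewrite !mulf_eq0 !expf_eq0.
    rewrite (negPf c0) (negPf z10) !andbF /=.
    move=> H; apply/eqP/H.
    by rewrite (leq_ltn_trans (leq_subr _ _)) // prednK // (cs_m_gt0 S).
  have [y1 y1m] := root_exists ((1 - z ^+ m) / (a * z ^+ m + 1)) (cs_m_gt0 S).
  have fP : a * z ^+ m * y1 ^+ m + z ^+ m + y1 ^+ m = 1 by rewrite y1m; field.
  have [A [B [BP AB]]] := regular_local_ring fP Rg.
  apply: (no_pole fP lm BP Mz (A := A)).
  by rewrite -gE -AB; ring.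
have /size_poly1P[c c0 ME] : size M == 1%N by rewrite sM.
pose P := c^-1 *: N.
have jc0 : j c != 0 by rewrite fmorph_eq0.
have gP : g = (map_poly j P).[x] * y ^+ l.
  rewrite map_polyZ hornerZ /= fmorphV; apply: (mulIf Mx0); rewrite gE ME.
  by rewrite map_polyC hornerC /=; field.
have P0 : P != 0 by rewrite scaler_eq0 invr_eq0 (negPf c0).
have gP1 : g * (map_poly j 1).[x] = (map_poly j P).[x] * y ^+ l.
  by rewrite rmorph1 hornerC mulr1.
set d := (size P).-1; have sPd : (size P <= d.+1)%N by rewrite prednK // size_poly_gt0.
have s1d : (size (1%R : {poly K}) <= d.+1)%N by rewrite size_poly1.
have sP : (size P <= m.-1)%N.
  rewrite leqNgt; apply/negP => mP.
  have dm : (m.-2 < d)%N.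
    have d1 : d.+1 = size P by rewrite /d prednK ?size_poly_gt0.
    by rewrite -ltnS d1; move: mP; case: (m) (cs_m_gt2 S) => [|[|k]].
  have fP : a * 0 ^+ m * 1 ^+ m + 0 ^+ m + 1 ^+ m = 1 :> K.
    by rewrite expr1n expr0n gtn_eqF ?(cs_m_gt0 S) // mulr0 mul0r !add0r.
  have [A [B [e [e0 BP E]]]] := regular_at_inverse bm s0x s0y fP Rg lm sPd s1d gP1.
  have x0 := cs_y_neq0 S'.
  have : ev (e%:P%:P * px (inv_poly b d P) * 'Y ^+ (m.-1 - l) * B) =
         ev (A * 'Y * 'X ^+ (d - m.-2)).
    apply: (mulIf (expf_neq0 m.-2 x0)).
    rewrite !eval_atM !eval_atXn eval_atX eval_atY eval_atCC eval_at_poly.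
    rewrite -[RHS]mulrA -exprD subnK ?(ltnW dm) //.
    move: E; rewrite rmorphM /= map_polyZ map_polyXn hornerM hornerZ hornerXn /=.
    rewrite (horner_inv_poly b j x0 s1d) rmorph1 hornerC mulr1.
    by rewrite eval_atM eval_atY => <-; ring.
  move/(eval_point_eq S fP); rewrite !eval_atM !eval_atXn eval_atX eval_atY eval_atCC.
  rewrite eval_at_poly map_poly_id // horner_inv_poly0.
  rewrite expr1n [0 ^+ (d - _)]expr0n gtn_eqF ?subn_gt0 // mulr0 => /eqP.
  rewrite !mulf_eq0 expf_eq0 (negPf e0) (negPf b0) (negPf BP) andbF oner_eq0 !orbF /=.
  by rewrite -[_ _ d]/(lead_coef P) lead_coef_eq0 (negPf P0).
exists P; split=> // lE; exfalso.
have rootsP : all (root P) [seq b * zeta ^+ i | i <- iota 0 m].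
  apply/allP => _ /mapP[i _ ->]; set z := b * zeta ^+ i.
  have zz0 : zeta ^+ i != 0 by rewrite expf_neq0 ?(cs_zeta_neq0 S).
  have az : a * z ^+ m + 1 = 0.
    rewrite exprMn bm -exprM mulnC exprM (prim_expr_order (cs_zeta_prim S)) expr1n.
    by rewrite mulr1 mulrN divff ?(cs_a_neq0 S) // addNr.
  have [z0 z1m] := z_inv z az.
  have [A [B [e [e0 BP E]]]] :=
    regular_at_inverse bm s0x s0y (fP0 _ z1m) Rg lm sPd s1d gP1.
  have z10 : b / z != 0 by rewrite mulf_neq0 ?invr_eq0.
  have bbz : b / (b / z) = z by rewrite invf_div mulrC divfK.
  have : ev (px (e *: 'X^(m.-2) * inv_poly b d P) * B) =
         ev (A * 'Y * px (inv_poly b d 1)).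
    by rewrite 2!eval_atM !eval_at_poly -E lE subnn expr0 mulr1.
  move/(eval_point_eq S (fP0 _ z1m)); rewrite !eval_atM eval_atY mulr0 mul0r => /eqP.
  rewrite eval_at_poly map_poly_id // mulf_eq0 (negPf BP) orbF.
  rewrite hornerM hornerZ hornerXn horner_inv_poly_id // bbz.
  rewrite !mulf_eq0 !expf_eq0 (negPf e0) (negPf z10) !andbF /=.
  by [].
have := max_poly_roots P0 rootsP; rewrite map_inj_in_uniq ?iota_uniq.
  rewrite size_map size_iota => /(_ isT) mP.
  by have := leq_trans mP sP; rewrite ltnNge leq_pred.
move=> i1 i2; rewrite !mem_iota !add0n => /andP[_ i1m] /andP[_ i2m] /(mulfI b0)/eqP.
by rewrite (eq_prim_root_expr (cs_zeta_prim S)) !modn_small // => /eqP.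
Qed.

End RegularEigenvectors.

(** * Uniqueness of the two projections *)

Section Interpolation.
Variables (L : fieldType) (m : nat) (X Y w : 'I_m -> L).

Lemma relation_polys d (p q : {poly L}) :
  (forall k l, (k < d)%N -> (l < d)%N -> \sum_i w i * (X i ^+ k * Y i ^+ l) = 0) ->
  (size p <= d)%N -> (size q <= d)%N -> \sum_i w i * (p.[X i] * q.[Y i]) = 0.
Proof.
move=> rel sp sq.
transitivity (\sum_(k < d) \sum_(l < d) p`_k * q`_l *
    \sum_i w i * (X i ^+ k * Y i ^+ l)); last first.
  by rewrite big1 // => k _; rewrite big1 // => l _; rewrite rel // mulr0.
under [RHS]eq_bigr do under eq_bigr do rewrite mulr_sumr.
under [RHS]eq_bigr do rewrite exchange_big.
rewrite exchange_big; apply: eq_bigr => i _ /=.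
rewrite (horner_coef_wide _ sp) (horner_coef_wide _ sq) mulr_suml mulr_sumr.
apply: eq_bigr => k _; rewrite mulr_sumr mulr_sumr; apply: eq_bigr => l _.
by ring.
Qed.

(** Otherwise i1 differs from i0 in both coordinates, and the m - 1 points other
    than i0 can be split into at most m - 2 that differ from it in X and at most
    m - 2 that differ from it in Y: the point i1 can go to either side.  The
    product of the corresponding linear forms vanishes at all points but i0. *)
Lemma interpolation (i0 i1 : 'I_m) :
  (2 < m)%N -> i1 != i0 -> w i0 != 0 ->
  (forall i, i != i0 -> X i != X i0 \/ Y i != Y i0) ->
  (forall k l, (k < m.-1)%N -> (l < m.-1)%N ->
     \sum_i w i * (X i ^+ k * Y i ^+ l) = 0) ->
  X i1 = X i0 \/ Y i1 = Y i0.
Proof.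
move=> m2 i10 w0 sep rel.
have [|X1] := eqVneq (X i1) (X i0); first by left.
have [|Y1] := eqVneq (Y i1) (Y i0); first by right.
exfalso.
(* A and B split the points other than i0 and i1; then i1 is put where room is left. *)
pose U := [pred i : 'I_m | (i != i0) && (i != i1)].
pose eqX := [pred i : 'I_m | X i != X i0].
pose A := enum [predI U & eqX]; pose B := enum [predD U & eqX].
have sAB : (size A + size B = m.-2)%N.
  rewrite /A /B -!cardE cardID.
  have := cardC (pred2 i0 i1); rewrite card_ord card2 eq_sym i10 => cE.
  rewrite -[in RHS]cE add2n /=; apply: eq_card => i.
  by rewrite !inE negb_or.
have m12 e : (e < m.-2)%N -> (e.+1 < m.-1)%N.
  by clear -m2; case: (m) m2 => [|[|k]].
have m12' e : (e <= m.-2)%N -> (e < m.-1)%N.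
  by clear -m2; case: (m) m2 => [|[|k]].
have [A' [B' [sA' sB' inAB X0 Y0]]] : exists A' B' : seq 'I_m,
    [/\ (size A' < m.-1)%N, (size B' < m.-1)%N,
      forall i, i != i0 -> i \in A' \/ i \in B',
      forall i, i \in A' -> X i != X i0 & forall i, i \in B' -> Y i != Y i0].
  have inA i : i \in A -> X i != X i0 by rewrite mem_enum !inE => /andP[].
  have inB i : i \in B -> Y i != Y i0.
    rewrite mem_enum !inE negbK => /andP[/eqP Xi /andP[ii0 _]].
    by case: (sep i ii0); rewrite ?Xi ?eqxx.
  have cover i : i != i0 -> i != i1 -> i \in A \/ i \in B.
    move=> ii0 ii1; rewrite !mem_enum !inE ii0 ii1 /=.
    by case: (X i != X i0); [left|right].
  have [sA|sA] := ltnP (size A) m.-2.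
    exists (i1 :: A), B; split=> [||i ii0|i|i] /=.
    - exact: m12.
    - by apply: m12'; rewrite -sAB leq_addl.
    - rewrite inE; have [-> | ii1] := eqVneq i i1; first by left.
      exact: cover.
    - by rewrite inE => /orP[/eqP -> //|/inA].
    - exact: inB.
  have B0 : size B = 0%N by move: sAB sA; lia.
  exists A, (i1 :: B); split=> [||i ii0|i|i] /=.
  - by apply: m12'; rewrite -sAB leq_addr.
  - by rewrite B0; apply: m12; case: (m) m2 => [|[|[|k]]].
  - rewrite inE; have [-> | ii1] := eqVneq i i1; first by right.
    exact: cover.
  - exact: inA.
  - by rewrite inE => /orP[/eqP -> //|/inB].
pose p := \prod_(i <- A') ('X - (X i)%:P); pose q := \prod_(i <- B') ('X - (Y i)%:P).
have : \sum_i w i * (p.[X i] * q.[Y i]) = 0.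
  by apply: relation_polys rel _ _; rewrite size_prod_XsubC.
rewrite (bigD1 i0) //= big1 ?addr0 => [|i ii0].
  apply/eqP; rewrite !mulf_neq0 // horner_prod prodf_seq_neq0; apply/allP => i /=.
    by move=> /X0; rewrite !hornerE subr_eq0 eq_sym.
  by move=> /Y0; rewrite !hornerE subr_eq0 eq_sym.
have [iA|iB] := inAB i ii0.
  have -> : p.[X i] = 0; last by rewrite mul0r mulr0.
  by apply/eqP; rewrite horner_prod prodf_seq_eq0; apply/hasP; exists i;
     rewrite //= !hornerE subrr.
have -> : q.[Y i] = 0; last by rewrite !mulr0.
by apply/eqP; rewrite horner_prod prodf_seq_eq0; apply/hasP; exists i;
   rewrite //= !hornerE subrr.
Qed.

End Interpolation.

Section Uniqueness.
Variables (K : closedFieldType) (L : fieldType) (j : {rmorphism K -> L}).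
Variables (x y : L) (a zeta : K) (m : nat).
Hypothesis S : curve_setting j x y a zeta m.
Notation ev := (eval_at j x y).
Notation D := (der S).
Notation R := (regular j D).
Variable g : kaut j.
Hypotheses (gx : g x = x) (gy : g y = j zeta * y).

Let zeta_m : zeta ^+ m = 1. Proof. exact: prim_expr_order (cs_zeta_prim S). Qed.

Lemma regular_rotation r : R r -> R (g r).
Proof.
move=> /(regular_der_kaut g) Rr.
have z0 : j zeta ^+ m.-1 != 0 by rewrite expf_neq0 // fmorph_eq0 (cs_zeta_neq0 S).
have fE : der_factor S g = (j zeta ^+ m.-1)^-1.
  rewrite /der_factor gx der_x.
  have -> : g (cs_fy j x y a m) = j zeta ^+ m.-1 * cs_fy j x y a m.
    rewrite /cs_fy !(rmorphM, rmorphD, rmorphXn, rmorph_nat, rmorph1) /=.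
    by rewrite gx gy kautj exprMn; ring.
  by rewrite invfM mulrCA divff ?mulr1 // (cs_fy_neq0 S).
have := regularZ (zeta ^+ m.-1) Rr.
by rewrite fE rmorphXn mulVKf.
Qed.

Lemma regular_eigen l r : R r -> (l < m)%N -> g r = j zeta ^+ l * r ->
  exists P : {poly K}, [/\ (size P <= m.-1)%N,
    r = (map_poly j P).[x] * y ^+ l & l = m.-1 -> P = 0].
Proof.
move=> Rr lm gr; have yl0 : y ^+ l != 0 by rewrite expf_neq0 ?(cs_y_neq0 S).
have zl0 : j zeta ^+ l != 0 by rewrite expf_neq0 // fmorph_eq0 (cs_zeta_neq0 S).
have gfix : g (r / y ^+ l) = r / y ^+ l.
  rewrite fmorph_div rmorphXn /= gr gy exprMn.
  by field; rewrite zl0 yl0.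
have [N [M [M0 E]]] := rotation_fixed_field S gx gy gfix.
by apply: (regular_eigen_poly (N := N) Rr lm M0); rewrite -E; field.
Qed.

Lemma iter_rotation k z : iter (k + m) g z = iter k g z.
Proof.
rewrite iterD; congr (iter k g _).
rewrite [z](num_denE (cs_function_field S)).
set u := num _ z; set v := den _ z.
have iterM i (z1 z2 : L) : iter i g (z1 / z2) = iter i g z1 / iter i g z2.
  by elim: i => //= i ->; rewrite fmorph_div.
by rewrite iterM !(iter_eval gx gy) -rmorphXn zeta_m rmorph1 mul1r.
Qed.

(** The sum is a regular eigenvector of eigenvalue zeta^(m-1), that is, a
    polynomial c(x) times y^(m-1); but such a c must vanish. *)
Lemma regular_sum_rotations h : R h -> \sum_(k < m) j zeta ^+ k * iter k g h = 0.
Proof.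
move=> Rh; set r := \sum_(k < m) _.
have Rr : R r.
  apply: regular_sum => k; rewrite -rmorphXn; apply: regularZ.
  by elim: (nat_of_ord k) => //= i IHi; apply: regular_rotation.
have zgr : j zeta * g r = r.
  rewrite /r rmorph_sum mulr_sumr.
  have := big_ord_recl m (fun k : 'I_m.+1 => j zeta ^+ k * iter k g h)
    (idx := 0) (op := +%R).
  rewrite big_ord_recr /= -(rmorphXn j) zeta_m -[in iter m g h](add0n m) iter_rotation.
  rewrite rmorph1 expr0 addrC => /addrI ->.
  apply: eq_bigr => k _; rewrite rmorphM rmorphXn /= kautj mulrA -exprS.
  by [].
have gr : g r = j zeta ^+ m.-1 * r.
  by rewrite -{2}zgr mulrA -exprSr (prednK (cs_m_gt0 S)) -rmorphXn zeta_m rmorph1 mul1r.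
have m1 : (m.-1 < m)%N by rewrite prednK ?(cs_m_gt0 S).
have [P [_ -> /(_ erefl) ->]] := regular_eigen Rr m1 gr.
by rewrite rmorph0 horner0 mul0r.
Qed.

(** The conjugate of a rotation of one projection is a rotation of one of the
    two projections: this is the uniqueness of the two projections. *)
Lemma conj_rotation_fixes_coordinate (s : kaut j) :
  s (g (s^-1%g x)) = x \/ s (g (s^-1%g y)) = y.
Proof.
have m0 := cs_m_gt0 S; have m2 := cs_m_gt2 S.
pose i0 := Ordinal m0; pose i1 := Ordinal (ltnW m2).
pose tau k z := s (iter k g (s^-1%g z)).
pose c := (der_factor S s)^-1.
have tauM k z1 z2 : tau k (z1 * z2) = tau k z1 * tau k z2.
  have iM i (u v : L) : iter i g (u * v) = iter i g u * iter i g v.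
    by elim: i => //= i ->; rewrite rmorphM.
  by rewrite /tau rmorphM iM rmorphM.
have tauX k z e : tau k (z ^+ e) = tau k z ^+ e.
  have tau1 : tau k 1 = 1.
    rewrite /tau rmorph1; have -> : iter k g 1 = 1 by elim: k => //= k ->; rewrite rmorph1.
    by rewrite rmorph1.
  by elim: e => [|e IHe]; rewrite ?expr0 // !exprS tauM IHe.
have := @interpolation L m (fun i => tau i x) (fun i => tau i y)
  (fun i => j zeta ^+ i * tau i c) i0 i1 m2.
rewrite /tau /= !kautVK; apply=> //.
- by rewrite expr0 mul1r invr_eq0 der_factor_neq0.
- move=> i ii0; have [xi|xi] := eqVneq (s (iter i g (s^-1%g x))) x; last by left.
  right; apply/negP => /eqP yi.
  have fixz z : s (iter i g (s^-1%g z)) = z.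
    pose t : kaut j := (s * iter i ( *%g g) 1 * s^-1)%g.
    have tE z' : t z' = s (iter i g (s^-1%g z')).
      rewrite /t !kautM; congr (s _).
      by elim: (nat_of_ord i) => //= k <-.
    have -> : s (iter i g (s^-1%g z)) = (1%g : kaut j) z; last by [].
    by rewrite -tE; congr (kaut_fun _ _); apply: (kaut_ext (cs_function_field S)); rewrite tE.
  have := fixz (s y); rewrite kautK => /fmorph_inj.
  have -> : y = ev 'Y by rewrite eval_atY.
  rewrite (iter_eval gx gy) !eval_atY => /esym/eqP.
  rewrite -subr_eq0 -{1}[y]mul1r -mulrBl mulf_eq0 (negPf (cs_y_neq0 S)) orbF.
  rewrite subr_eq0 -rmorphXn eq_sym fmorph_eq1 -(prim_order_dvd (cs_zeta_prim S)).
  rewrite gtnNdvd // lt0n; apply: contra ii0 => /eqP i00.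
  by apply/eqP/val_inj.
move=> k l km lm.
have Rh : R (s^-1%g (x ^+ k * y ^+ l / der_factor S s)).
  apply: regular_der_kaut_inv => O OV.
  apply: (regular_at_monomial (zeta := zeta) (m := m) (a := a) (der_is_derivation S) OV).
  - exact: S.
  - exact: der_x.
  - exact: der_y.
  - by move: km; case: (m) => [|[|e]].
  - by move: lm; case: (m) => [|[|e]].
have := congr1 s (regular_sum_rotations Rh); rewrite rmorph0 rmorph_sum => E.
rewrite -[RHS]E; apply: eq_bigr => i _.
rewrite [in RHS]rmorphM rmorphXn /= kautj.
have -> : s (iter i g (s^-1%g (x ^+ k * y ^+ l / der_factor S s))) =
    tau i x ^+ k * tau i y ^+ l * tau i c by rewrite -!tauX -!tauM.
by rewrite -mulrA; congr (_ * _); rewrite mulrC.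
Qed.

End Uniqueness.

(** * Normality of the group of rotations *)

Section Torus.
Variables (K : closedFieldType) (L : fieldType) (j : {rmorphism K -> L}).
Variables (x y : L) (a zeta : K) (m : nat).
Hypothesis S : curve_setting j x y a zeta m.
Let zP := cs_zeta_prim S.
Let y0 := cs_y_neq0 S.

Definition in_torus (s : kaut j) : Prop :=
  exists c d : K, [/\ c ^+ m = 1, d ^+ m = 1, s x = j c * x & s y = j d * y].

Lemma in_torus_subgroup : is_subgroup in_torus.
Proof.
split=> [|s t|s].
- by exists 1, 1; rewrite expr1n rmorph1 !mul1r.
- move=> [c [d [cm dm sx sy]]] [c' [d' [cm' dm' tx ty]]].
  exists (c' * c), (d' * d); rewrite !exprMn cm dm cm' dm' mulr1 !kautM tx ty.
  by rewrite !rmorphM /= !kautj sx sy /= !mulrA.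
move=> [c [d [cm dm sx sy]]]; exists c^-1, d^-1.
have nz (e : K) : e ^+ m = 1 -> e != 0 by apply: (unity_root_neq0 S).
have inv_eq (e : K) t : e ^+ m = 1 -> s t = j e * t -> s^-1%g t = j e^-1 * t.
  move=> em st; apply: (can_inj (kautK s)); rewrite kautVK rmorphM /= kautj st mulrA.
  by rewrite -rmorphM mulVf ?nz // rmorph1 mul1r.
by rewrite !exprVn cm dm invr1; split=> //; apply: inv_eq.
Qed.

Lemma torus_groupP s : torus_group j x y zeta s <-> in_torus s.
Proof.
split=> [H|[c [d [cm dm sx sy]]]].
  apply: (H in_torus); split; first exact: in_torus_subgroup.
  have z1 := prim_expr_order zP.
  move=> t [[tx ty]|[tx ty]]; [exists zeta, 1|exists 1, zeta];
    by rewrite expr1n rmorph1 mul1r.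
move=> M [[M1 MM MV] EM].
have z1 := prim_expr_order zP.
have [g1 [g1x g1y]] := torus_exists S z1 (expr1n _ m).
have [g2 [g2x g2y]] := torus_exists S (expr1n _ m) z1.
rewrite rmorph1 mul1r in g1y; rewrite rmorph1 mul1r in g2x.
have Mexp g i : M g -> M (g ^+ i)%g.
  by move=> Mg; elim: i => [|i IHi]; [rewrite expg0|rewrite expgS; apply: MM].
have [i cE] := prim_rootP zP cm; have [k dE] := prim_rootP zP dm.
have -> : s = (g1 ^+ i * g2 ^+ k)%g.
  apply: (kaut_ext (cs_function_field S)); rewrite kautM.
    by rewrite (expg_fix k g2x) (expg_scale i g1x) -cE.
  by rewrite (expg_scale k g2y) -dE kautZ (expg_fix i g1y).
by apply: MM; apply: Mexp; apply: EM; [left|right].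
Qed.

(** The power y^m is a fraction in x, so it is fixed as well. *)
Lemma fix_x_scales (t : kaut j) : t x = x ->
  exists d, d ^+ m = 1 /\ t y = j d * y.
Proof.
move=> tx.
have au0 := cs_au1_neq0 S.
have ym : t y ^+ m = y ^+ m.
  have vE : y ^+ m = (1 - x ^+ m) / (j a * x ^+ m + 1).
    by apply: (mulIf au0); rewrite divfK // (cs_kummer_eq S).
  rewrite -rmorphXn vE fmorph_div rmorphB rmorphD rmorphM !rmorphXn rmorph1 /=.
  by rewrite kautj tx.
have q1 : (t y / y) ^+ m = 1.
  by rewrite exprMn ym exprVn divff // expf_neq0.
have zLP : m.-primitive_root (j zeta) by rewrite fmorph_primitive_root.
have [i E] := prim_rootP zLP q1.
exists (zeta ^+ i); rewrite -exprM mulnC exprM (prim_expr_order zP) expr1n.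
by rewrite rmorphXn -E divfK.
Qed.

Lemma fix_x_in_torus (t : kaut j) : t x = x -> in_torus t.
Proof.
move=> tx; have [d [dm ty]] := fix_x_scales tx.
by exists 1, d; rewrite expr1n tx rmorph1 mul1r.
Qed.

End Torus.

Arguments in_torus {K L} j x y m s.

Lemma in_torus_swap (K : closedFieldType) (L : fieldType)
    (j : {rmorphism K -> L}) (x y : L) (m : nat) s :
  in_torus j x y m s -> in_torus j y x m s.
Proof. by move=> [c [d [cm dm sx sy]]]; exists d, c. Qed.

Section FixedCoordinates.
Variables (K : closedFieldType) (L : fieldType) (j : {rmorphism K -> L}).
Variables (x y : L) (a zeta : K) (m : nat).
Hypothesis S : curve_setting j x y a zeta m.
Let S' := curve_setting_swap S.
Let zP := cs_zeta_prim S.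
Let x0 := cs_y_neq0 S'.
Let y0 := cs_y_neq0 S.
Let m0 := cs_m_gt0 S.
Variables (g1 g2 : kaut j).
Hypotheses (g1x : g1 x = j zeta * x) (g1y : g1 y = y).
Hypotheses (g2x : g2 x = x) (g2y : g2 y = j zeta * y).

Let zeta_neq1 t : t != 0 -> j zeta * t <> t.
Proof.
move=> t0 /eqP; rewrite -{2}[t]mul1r (inj_eq (mulIf t0)) fmorph_eq1.
rewrite -[zeta]expr1 -(prim_order_dvd zP) dvdn1.
by have := cs_m_gt2 S; case: (m) => [|[|k]].
Qed.

(** The conjugate s^-1 g2 s fixes x and has the order m of g2, hence it is a
    rotation of y by a primitive root of unity. *)
Lemma conj_primitive (s : kaut j) : g2 (s x) = s x ->
  exists d, [/\ m.-primitive_root d, (s^-1 * g2 * s)%g x = x &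
    (s^-1 * g2 * s)%g y = j d * y].
Proof.
move=> /conj_fix tx; set t := (s^-1 * g2 * s)%g in tx *.
have [d [dm ty]] := fix_x_scales S tx; exists d; split=> //.
have [k kP km] := prim_order_exists m0 dm.
have tk1 : (t ^+ k)%g = 1%g.
  apply: (kaut_ext (cs_function_field S)); first exact: expg_fix.
  by rewrite (expg_scale k ty) (prim_expr_order kP) rmorph1 mul1r.
have g2k : (g2 ^+ k)%g = 1%g.
  move: tk1; rewrite /t conj_exp => E.
  have -> : (g2 ^+ k = s * (s^-1 * g2 ^+ k * s) * s^-1)%g.
    by rewrite !mulgA mulgV mul1g mulgK.
  by rewrite E mulg1 mulgV.
have mk : (m %| k)%N.
  rewrite (prim_order_dvd zP); have := expg_scale k g2y; rewrite g2k kaut1 => /eqP.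
  by rewrite -{1}[y]mul1r (inj_eq (mulIf y0)) eq_sym fmorph_eq1.
by have -> : m = k by apply/eqP; rewrite eqn_dvd mk km.
Qed.

(** Otherwise s^-1 g1 s and s^-1 g2 s would be in the same cyclic group of
    order m, of which s^-1 g2 s is a generator; then g1 would be a power of g2. *)
Lemma not_both_fix (s : kaut j) : g2 (s x) = s x -> g1 (s x) <> s x.
Proof.
move=> /conj_primitive[d [dP tx ty]] /conj_fix ux.
have [e [em uy]] := fix_x_scales S ux.
have [k eE] := prim_rootP dP em.
have uE : (s^-1 * g1 * s = (s^-1 * g2 * s) ^+ k)%g.
  apply: (kaut_ext (cs_function_field S)); first by rewrite ux expg_fix.
  by rewrite uy (expg_scale k ty) eE.
have g1E : (g1 = g2 ^+ k)%g.
  by move: uE; rewrite conj_exp => /mulIg/mulgI.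
by apply: (zeta_neq1 x0); rewrite -g1x g1E expg_fix.
Qed.

(** The automorphisms that preserve the two projections: K(x) is the field
    fixed by g2 and K(y) is the field fixed by g1. *)
Definition straight (s : kaut j) := g2 (s x) = s x /\ g1 (s y) = s y.
Definition crossed (s : kaut j) := g2 (s y) = s y /\ g1 (s x) = s x.

End FixedCoordinates.

Section Normality.
Variables (K : closedFieldType) (L : fieldType) (j : {rmorphism K -> L}).
Variables (x y : L) (a zeta : K) (m : nat).
Hypothesis S : curve_setting j x y a zeta m.
Let S' := curve_setting_swap S.
Variables (g1 g2 : kaut j).
Hypotheses (g1x : g1 x = j zeta * x) (g1y : g1 y = y).
Hypotheses (g2x : g2 x = x) (g2y : g2 y = j zeta * y).

Lemma straight_or_crossed s : straight x y g1 g2 s \/ crossed x y g1 g2 s.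
Proof.
have d2 : g2 (s x) = s x \/ g2 (s y) = s y.
  have := conj_rotation_fixes_coordinate S g2x g2y s^-1%g.
  rewrite invgK => -[E|E]; [left|right]; by rewrite -[in RHS]E kautVK.
have d1 : g1 (s y) = s y \/ g1 (s x) = s x.
  have := conj_rotation_fixes_coordinate S' g1y g1x s^-1%g.
  rewrite invgK => -[E|E]; [left|right]; by rewrite -[in RHS]E kautVK.
case: d2 => d2; case: d1 => d1; [by left| | |by right].
  by have := not_both_fix S g1x g2x g2y d2.
by have := not_both_fix S' g2y g1y g1x d1.
Qed.

Lemma torus_conj_gen s : in_torus j x y m (s^-1 * g1 * s)%g /\
  in_torus j x y m (s^-1 * g2 * s)%g.
Proof.
case: (straight_or_crossed s) => -[/conj_fix h2 /conj_fix h1]; split.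
- by apply: in_torus_swap; apply: (fix_x_in_torus S' h1).
- exact: (fix_x_in_torus S h2).
- exact: (fix_x_in_torus S h1).
- by apply: in_torus_swap; apply: (fix_x_in_torus S' h2).
Qed.

Lemma torus_normal : is_normal (torus_group j x y zeta).
Proof.
have torE := torus_groupP S.
have sub : is_subgroup (in_torus j x y m) := in_torus_subgroup S.
have [s1 sM sV] := sub; split.
  split; first exact/torE.
  - by move=> s t /torE s_in /torE t_in; apply/torE/sM.
  - by move=> s /torE s_in; apply/torE/sV.
move=> s t Hs; apply/torE.
have Cs : is_subgroup (fun u : kaut j => in_torus j x y m (u ^ t)%g).
  split=> [|u v|u].
  - by rewrite conj1g.
  - by rewrite conjMg; apply: sM.
  - by rewrite conjVg; apply: sV.
apply: (Hs (fun u : kaut j => in_torus j x y m (u ^ t)%g)); split=> //.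
move=> u [[ux uy]|[ux uy]] /=; rewrite conjgE mulgA.
- have -> : u = g1 by apply: (kaut_ext (cs_function_field S)); rewrite ?ux ?uy.
  by have [] := torus_conj_gen t.
- have -> : u = g2 by apply: (kaut_ext (cs_function_field S)); rewrite ?ux ?uy.
  by have [] := torus_conj_gen t.
Qed.

End Normality.

(** * The group of rotations as an abstract group *)

Section TorusGroup.
Variables (K : closedFieldType) (L : fieldType) (j : {rmorphism K -> L}).
Variables (x y : L) (a zeta : K) (m : nat).
Hypothesis S : curve_setting j x y a zeta m.
Let zP := cs_zeta_prim S.

Lemma torus_isomorphic :
  subgroup_isomorphic (torus_group j x y zeta) ('Z_m * 'Z_m)%type.
Proof.
have z1 := prim_expr_order zP.
have tex (p : 'Z_m * 'Z_m) :
    exists s : kaut j, s x = j (zeta ^+ p.1) * x /\ s y = j (zeta ^+ p.2) * y.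
  by apply: (torus_exists S); rewrite -exprM mulnC exprM z1 expr1n.
pose f p := sval (cid (tex p)).
have fP p : f p x = j (zeta ^+ p.1) * x /\ f p y = j (zeta ^+ p.2) * y.
  by rewrite /f; case: cid.
have ext := kaut_ext (cs_function_field S).
have Zm : ((Zp_trunc m).+2 = m)%N by apply: Zp_cast; apply: ltnW (cs_m_gt2 S).
have modZ k : zeta ^+ (k %% (Zp_trunc m).+2) = zeta ^+ k.
  by rewrite Zm (prim_expr_mod zP).
have zD (u v : 'Z_m) : zeta ^+ (u * v)%g = zeta ^+ u * zeta ^+ v.
  by rewrite FinRing.zmodMgE /= modZ exprD.
have fM : {morph f : p q / (p * q)%g}.
  move=> p q; have [px py] := fP p; have [qx qy] := fP q.
  have [pqx pqy] := fP (p * q)%g.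
  apply: ext; rewrite kautM ?qx ?qy rmorphM /= kautj ?px ?py ?pqx ?pqy /= zD rmorphM /=.
    by rewrite mulrA [X in X * _]mulrC.
  by rewrite mulrA [X in X * _]mulrC.
pose F : {multiplicative ('Z_m * 'Z_m)%type -> kaut j} :=
  HB.pack f (isMultiplicative.Build _ _ f fM).
exists F; split.
  have inj_z (u v : 'Z_m) t : t != 0 -> j (zeta ^+ u) * t = j (zeta ^+ v) * t -> u = v.
    move=> t0 /(mulIf t0)/fmorph_inj/eqP; rewrite (eq_prim_root_expr zP) => /eqP.
    have lt (w : 'Z_m) : (w < m)%N by rewrite -{2}Zm ltn_ord.
    by rewrite !modn_small ?lt // => /val_inj.
  move=> [p1 p2] [q1 q2] pqF; have pq : f (p1, p2) = f (q1, q2) by exact: pqF.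
  have [px py] := fP (p1, p2); have [qx qy] := fP (q1, q2).
  have -> : p1 = q1.
    apply: (inj_z _ _ x (cs_y_neq0 (curve_setting_swap S))); rewrite -px -qx.
    by rewrite pq.
  congr (_, _); apply: (inj_z _ _ y (cs_y_neq0 S)); rewrite -py -qy.
  by rewrite pq.
apply/seteqP; split=> [s [p _ <-]|s /(torus_groupP S)[c [d [cm dm sx sy]]]].
  apply/(torus_groupP S); have [px py] := fP p.
  exists (zeta ^+ p.1), (zeta ^+ p.2).
  by split=> //; rewrite -exprM mulnC exprM z1 expr1n.
have [i cE] := prim_rootP zP cm; have [k dE] := prim_rootP zP dm.
exists (inZp i, inZp k) => //; have [px py] := fP (inZp i, inZp k).
apply: ext; rewrite /F /= ?px ?py ?sx ?sy /= modZ.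
  by rewrite cE.
by rewrite dE.
Qed.
End TorusGroup.

(** * Automorphisms that preserve both projections *)

Section StraightMonomials.
Variables (K : closedFieldType) (L : fieldType) (j : {rmorphism K -> L}).
Variables (x y : L) (a zeta : K) (m : nat).
Hypothesis S : curve_setting j x y a zeta m.
Let S' := curve_setting_swap S.
Let zP := cs_zeta_prim S.
Let x0 := cs_y_neq0 S'.
Let y0 := cs_y_neq0 S.
Let m0 := cs_m_gt0 S.
Notation D := (der S).
Variables (g1 g2 : kaut j).
Hypotheses (g1x : g1 x = j zeta * x) (g1y : g1 y = y).
Hypotheses (g2x : g2 x = x) (g2y : g2 y = j zeta * y).

Lemma der_factorM (s t : kaut j) :
  der_factor S (s * t)%g = der_factor S s * s (der_factor S t).
Proof.
have sD0 : s (t (D x)) != 0 by rewrite !fmorph_eq0 der_x (cs_fy_neq0 S).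
apply: (mulIf sD0); rewrite -[s (t (D x))]/((s * t)%g (D x)) -der_kaut !kautM.
by rewrite der_kaut (der_kaut S t) rmorphM mulrA.
Qed.

(** A rotation by (c, d) maps omega to a constant multiple of itself. *)
Lemma der_factor_torus (t : kaut j) : in_torus j x y m t ->
  exists e, e != 0 /\ der_factor S t = j e.
Proof.
move=> [c [d [cm dm tx ty]]].
have nz (e : K) : e ^+ m = 1 -> e != 0 by apply: (unity_root_neq0 S).
exists (c / d ^+ m.-1); split.
  by rewrite mulf_neq0 ?invr_eq0 ?expf_neq0 ?nz.
have [DD DM Dj] := der_is_derivation S.
have jd0 : j d ^+ m.-1 != 0 by rewrite expf_neq0 // fmorph_eq0 nz.
have fy0 := cs_fy_neq0 S.
rewrite /der_factor tx DM Dj mul0r addr0 /= der_x.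
have -> : t (cs_fy j x y a m) = j d ^+ m.-1 * cs_fy j x y a m.
  rewrite /cs_fy !(rmorphM, rmorphD, rmorphXn, rmorph_nat, rmorph1) /=.
  rewrite tx ty kautj !exprMn -(rmorphXn j m c) cm rmorph1; ring.
by rewrite fmorph_div rmorphXn /=; field; rewrite jd0 fy0.
Qed.

(** The cocycle relation, applied to g s = s (s^-1 g s), where both g and
    s^-1 g s are rotations. *)
Lemma der_factor_eigen (g s : kaut j) : in_torus j x y m g ->
  in_torus j x y m (s^-1 * g * s)%g ->
  exists e, g (der_factor S s) = j e * der_factor S s.
Proof.
move=> /der_factor_torus[e [e0 gE]] /der_factor_torus[e' [e'0 tE]].
exists (e' / e); have := der_factorM g s.
have -> : (g * s = s * (s^-1 * g * s))%g by rewrite !mulgA mulgV mul1g.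
rewrite der_factorM tE gE kautj => E.
have je0 : j e != 0 by rewrite fmorph_eq0.
by apply: (mulfI je0); rewrite -E fmorph_div; field.
Qed.

Lemma eigenvalue_zeta (g : kaut j) e z : (g ^+ m)%g = 1%g -> z != 0 ->
  g z = j e * z -> exists2 i, (i < m)%N & e = zeta ^+ i.
Proof.
move=> gm z0 gz; have := expg_scale m gz; rewrite gm kaut1 => /eqP.
rewrite -{1}[z]mul1r (inj_eq (mulIf z0)) eq_sym fmorph_eq1 => /eqP em.
by have [i ->] := prim_rootP zP em; exists i.
Qed.

Lemma rotation_order : (g1 ^+ m)%g = 1%g /\ (g2 ^+ m)%g = 1%g.
Proof.
have z1 := prim_expr_order zP.
split; apply: (kaut_ext (cs_function_field S)); rewrite kaut1.
- by rewrite (expg_scale m g1x) z1 rmorph1 mul1r.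
- exact: expg_fix.
- exact: expg_fix.
- by rewrite (expg_scale m g2y) z1 rmorph1 mul1r.
Qed.

(** The eigenspaces of the group of rotations in the space of regular elements
    are lines, because the exponents are determined modulo m and less than m. *)
Lemma regular_monomial r i l : regular j D r -> (i < m)%N -> (l < m)%N ->
  g1 r = j zeta ^+ i * r -> g2 r = j zeta ^+ l * r ->
  exists c, r = j c * x ^+ i * y ^+ l.
Proof.
move=> Rr im lm g1r g2r.
have [P [sP rE _]] := regular_eigen g2x g2y Rr lm g2r.
have yl0 : y ^+ l != 0 by rewrite expf_neq0.
have Pz : (map_poly j P).[j zeta * x] = j zeta ^+ i * (map_poly j P).[x].
  apply: (mulIf yl0); rewrite -mulrA -rE -g1r rE rmorphM rmorphXn /= g1y.
  by rewrite -(eval_at_poly j x y) kaut_eval eval_at_poly g1x.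
pose Q := \poly_(k < size P) (P`_k * (zeta ^+ k - zeta ^+ i)).
have Q0 : Q = 0.
  apply/eqP/negPn/negP => /(cs_transcendentalY S')/negP[].
  have sQ : (size Q <= size P)%N by apply: size_poly.
  rewrite (@horner_coef_wide _ (size P)) ?size_map_poly //.
  have <- : (map_poly j P).[j zeta * x] - j zeta ^+ i * (map_poly j P).[x] = 
     \sum_(k < size P) (map_poly j Q)`_k * x ^+ k.
    rewrite !(@horner_coef_wide _ (size P)) ?size_map_poly // mulr_sumr -sumrB.
    apply: eq_bigr => k _; rewrite !coef_map coef_poly ltn_ord /=.
    rewrite rmorphM rmorphB !rmorphXn exprMn /=; ring.
  by rewrite Pz subrr.
exists P`_i; rewrite rE; congr (_ * _).
have -> : P = P`_i *: 'X^i; last first.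
  by rewrite map_polyZ map_polyXn hornerZ hornerXn coefZ coefXn eqxx mulr1.
apply/polyP => k; rewrite coefZ coefXn; have [->|ki] := eqVneq k i; first by rewrite mulr1.
rewrite mulr0; have [kP|kP] := ltnP k (size P); last by rewrite nth_default.
have km : (k < m)%N.
  by apply: leq_trans kP (leq_trans sP (leq_pred _)).
have := congr1 (fun q : {poly K} => q`_k) Q0; rewrite coef_poly kP coef0 => /eqP.
rewrite mulf_eq0 subr_eq0 (eq_prim_root_expr zP) !modn_small // (negPf ki) orbF.
by move/eqP.
Qed.

(** Both 1 and x are regular, so their images, multiplied by the factor of s,
    are regular eigenvectors, hence monomials.  Their quotient is s x, and the
    exponents of y agree since g2 fixes s x. *)
Lemma straight_power (s : kaut j) : straight x y g1 g2 s ->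
  exists c (k : int), c != 0 /\ s x = j c * x ^ k.
Proof.
move=> sS; have [h2 h1] := sS.
have z1 := prim_expr_order zP.
have tg1 : in_torus j x y m g1 by exists zeta, 1; rewrite expr1n rmorph1 mul1r.
have tg2 : in_torus j x y m g2 by exists 1, zeta; rewrite expr1n rmorph1 mul1r.
(* The factor of s, which is the image of 1, is itself an eigenvector. *)
have [c1 c2] := torus_conj_gen S g1x g1y g2x g2y s.
have [[o1 o2] l0] := (rotation_order, der_factor_neq0 S s).
have [e1 l1] := der_factor_eigen tg1 c1; have [e2 l2] := der_factor_eigen tg2 c2.
have [i1 im e1E] := eigenvalue_zeta o1 l0 l1.
have [i2 im2 e2E] := eigenvalue_zeta o2 l0 l2.
have R0 : regular j D (der_factor S s).
  have := regular_at_monomial; move=> H.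
  have R1 : regular j D 1.
    move=> O OV; have := H _ _ _ a zeta m D O (der_is_derivation S) OV x y 0%N 0%N S.
    by rewrite !expr0 mulr1; apply; rewrite ?der_x ?der_y.
  by have := regular_der_kaut s R1; rewrite rmorph1 mulr1.
have Rx : regular j D (der_factor S s * s x).
  apply: regular_der_kaut => O OV.
  have := @regular_at_monomial _ _ _ a zeta m D O (der_is_derivation S) OV x y 1%N 0%N S.
  rewrite expr1 expr0 mulr1; apply; rewrite ?der_x ?der_y //.
  by have := cs_m_gt2 S; case: (m) => [|[|[|k]]].
(* g1 acts on s x by a scalar since s^-1 g1 s fixes y. *)
have [d [dm sx1]] : exists d, d ^+ m = 1 /\ g1 (s x) = j d * s x.
  have [d [dm E]] := fix_x_scales S' ((conj_fix s g1 y).2 h1).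
  exists d; split=> //; rewrite !kautM in E.
  by rewrite -[LHS](kautVK s) E rmorphM /= kautj.
have sx0 : s x != 0 by rewrite fmorph_eq0.
have lx0 : der_factor S s * s x != 0 by rewrite mulf_neq0.
have lx1 : g1 (der_factor S s * s x) = j (e1 * d) * (der_factor S s * s x).
  by rewrite (rmorphM g1) /= l1 sx1 rmorphM /=; ring.
have lx2 : g2 (der_factor S s * s x) = j zeta ^+ i2 * (der_factor S s * s x).
  by rewrite (rmorphM g2) /= l2 h2 e2E rmorphXn mulrA.
have [i3 im3 e3E] := eigenvalue_zeta o1 lx0 lx1.
rewrite e3E rmorphXn in lx1; rewrite e1E rmorphXn in l1; rewrite e2E rmorphXn in l2.
have [c cE] := regular_monomial R0 im im2 l1 l2.
have [c' c'E] := regular_monomial Rx im3 im2 lx1 lx2.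
have c0 : c != 0 by apply: contra_neq l0 => c0; rewrite cE c0 rmorph0 !mul0r.
have c'0 : c' != 0 by apply: contra_neq lx0 => c0'; rewrite c'E c0' rmorph0 !mul0r.
exists (c' / c), (i3%:Z - i1%:Z); split; first by rewrite mulf_neq0 ?invr_eq0.
have jc0 : j c != 0 by rewrite fmorph_eq0.
rewrite expfzDr // -exprnN -exprnP fmorph_div; apply: (mulfI l0); rewrite c'E cE.
by field; rewrite expf_neq0 // jc0.
Qed.

End StraightMonomials.

Section StraightUnits.
Variables (K : closedFieldType) (L : fieldType) (j : {rmorphism K -> L}).
Variables (x y : L) (a zeta : K) (m : nat).
Hypothesis S : curve_setting j x y a zeta m.
Let S' := curve_setting_swap S.
Let zP := cs_zeta_prim S.
Let x0 := cs_y_neq0 S'.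
Let y0 := cs_y_neq0 S.
Let m0 := cs_m_gt0 S.
Variables (g1 g2 : kaut j).
Hypotheses (g1x : g1 x = j zeta * x) (g1y : g1 y = y).
Hypotheses (g2x : g2 x = x) (g2y : g2 y = j zeta * y).

Lemma fix_inv (s : kaut j) : g2 (s x) = s x -> g2 (s^-1%g x) = s^-1%g x.
Proof.
move=> h; apply: (conj_fix s^-1%g g2 x).1; rewrite invgK.
have [d [dP tx ty]] := conj_primitive S g2y h.
have [e zE] := prim_rootP dP (prim_expr_order zP).
have g2E : (g2 = (s^-1 * g2 * s) ^+ e)%g.
  apply: (kaut_ext (cs_function_field S)); first by rewrite g2x expg_fix.
  by rewrite g2y (expg_scale e ty) -zE.
have -> : (s * g2 * s^-1 = g2 ^+ e)%g.
  by rewrite {1}g2E conj_exp !mulgA mulgV mul1g mulgK.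
exact: expg_fix.
Qed.

Lemma x_zpower_nonconstant c e (k : int) : c != 0 -> j c * x ^ k = j e -> k = 0.
Proof.
move=> c0; case: k => [[|k]|k] //.
  by move/eqP; rewrite -exprnP (negPf (cs_y_power_nonconstant S' _ (ltn0Sn k) c0)).
rewrite NegzE -exprnN => E; have xk0 : x ^+ k.+1 != 0 by rewrite expf_neq0.
have jc0 : j c != 0 by rewrite fmorph_eq0.
have e0 : e != 0.
  by apply: contra_neq jc0 => e0; apply: (mulIf (invr_neq0 xk0)); rewrite E e0 rmorph0 mul0r.
have := cs_y_power_nonconstant S' c (ltn0Sn k) e0; rewrite -E divfK //.
by rewrite eqxx.
Qed.

(** The inverse of s also maps x to a monomial, so the exponents of both are
    inverse integers. *)
Lemma straight_unit (s : kaut j) : straight x y g1 g2 s ->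
  exists c, c != 0 /\ (s x = j c * x \/ s x = j c / x).
Proof.
move=> sS; have sSV : straight x y g1 g2 s^-1%g.
  case: sS => h2 h1; split; first exact: fix_inv.
  have [e] : exists e, (s * g1 * s^-1 = g1 ^+ e)%g.
    have [d [dP tx ty]] := conj_primitive S' g1x h1.
    have [e zE] := prim_rootP dP (prim_expr_order zP); exists e.
    have g1E : (g1 = (s^-1 * g1 * s) ^+ e)%g.
      apply: (kaut_ext (cs_function_field S)); last by rewrite g1y expg_fix.
      by rewrite g1x (expg_scale e ty) -zE.
    by rewrite {1}g1E conj_exp !mulgA mulgV mul1g mulgK.
  move=> E; apply: (conj_fix s^-1%g g1 y).1; rewrite invgK E.
  exact: expg_fix.
have [c [k [c0 sx]]] := straight_power S g1x g1y g2x g2y sS.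
have [c' [k' [c'0 sVx]]] := straight_power S g1x g1y g2x g2y sSV.
have jc0 : j c != 0 by rewrite fmorph_eq0.
have kk : k * k' = 1.
  have E : j (c' * c ^ k') * x ^ (k * k' - 1) = j 1.
    have xE : j c' * (j c * x ^ k) ^ k' = x.
      by rewrite -sx -[RHS](kautVK s) sVx rmorphM /= kautj fmorphXz.
    rewrite expfzDr // exprN1 rmorphM fmorphXz -exprz_exp mulrA -[j c' * _ * _]mulrA.
    by rewrite -expfzMl xE divff // rmorph1.
  have c1 : c' * c ^ k' != 0 by rewrite mulf_neq0 // expfz_neq0.
  by apply/eqP; rewrite -subr_eq0; apply/eqP; apply: x_zpower_nonconstant c1 E.
exists c; split=> //.
have : `|k|%N == 1%N.
  have := congr1 absz kk; rewrite abszM => /eqP.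
  by rewrite muln_eq1 => /andP[].
move: sx; case: k {kk} => [[|[|k]]|[|k]] // sx _; [left|right].
  by rewrite sx expr1z.
by rewrite sx NegzE exprN1.
Qed.

(** The function x^m is transcendental over K. *)
Lemma quad_zero (q0 q1 q2 : K) :
  j q2 * (x ^+ m) ^+ 2 + j q1 * x ^+ m + j q0 = 0 -> [/\ q0 = 0, q1 = 0 & q2 = 0].
Proof.
move=> E; have u_tr : transcendental j (x ^+ m).
  apply: transcendental_notin => c.
  by have := cs_y_power_nonconstant S' c m0 (oner_neq0 K); rewrite rmorph1 mul1r.
pose Q := Poly [:: q0; q1; q2].
have Q0 : Q = 0.
  apply/eqP/negPn/negP => /u_tr/negP[]; rewrite /Q /= !cons_poly_def mul0r add0r.
  rewrite !(rmorphD, rmorphM) /= !map_polyC map_polyX !hornerE /=.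
  by apply/eqP; rewrite -[RHS]E; ring.
have coefQ i : Q`_i = 0 by rewrite Q0 coef0.
by split; [have := coefQ 0%N|have := coefQ 1%N|have := coefQ 2%N]; rewrite coef_Poly.
Qed.

Let kaut_curve (s : kaut j) : j a * s x ^+ m * s y ^+ m + s x ^+ m + s y ^+ m = 1.
Proof.
by have := congr1 s (cs_curve_eq S);
   rewrite !(rmorphD, rmorphM, rmorphXn, rmorph1) /= kautj.
Qed.

Let vE := cs_kummer_eq S.

(** Eliminating y^m from the image of the equation gives a quadratic relation
    for x^m; its constant term gives d^m = 1, and its linear term then gives
    (a + 1) (c^m - 1) = 0. *)
Lemma scaling_in_torus (s : kaut j) c d :
  s x = j c * x -> s y = j d * y -> in_torus j x y m s.
Proof.
move=> sx sy.
exists c, d; have := kaut_curve s; rewrite sx sy !exprMn -!rmorphXn.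
set C := c ^+ m; set E := d ^+ m => H.
have [q0 q1 _] : [/\ E - 1 = 0, a * C * E + C - E - a = 0 & a * C - a * C * E = 0].
  apply: quad_zero; rewrite !(rmorphD, rmorphN, rmorphM, rmorph1) /=.
  move: H vE (cs_au1_neq0 S); set u := x ^+ m; set v := y ^+ m => H vE' au0.
  apply: (mulIf au0); rewrite mul0r.
  transitivity ((j a * u + 1) * ((j a * (j C * u) * (j E) * (v * (j a * u + 1)) +
    j C * u * (j a * u + 1) + j E * (v * (j a * u + 1))) - (j a * u + 1))).
    by rewrite vE'; ring.
  transitivity ((j a * u + 1) ^+ 2 *
     (j a * (j C * u) * (j E * v) + j C * u + j E * v - 1)); first by ring.
  by rewrite H subrr mulr0.
have E1 : E = 1 by apply/eqP; rewrite -subr_eq0 q0.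
split=> //; apply/eqP; rewrite -subr_eq0.
apply/eqP/(mulfI (cs_a1_neq0 S)); rewrite mulr0 -[RHS]q1 E1; ring.
Qed.

(** The quadratic relation for x^m now gives d^m = -a and a d^m = -1, so
    a^2 = 1. *)
Lemma flip_forces_a1 (s : kaut j) c d : c != 0 ->
  s x = j c / x -> s y = j d * y -> a = 1.
Proof.
move=> c0 sx sy; have a0 := cs_a_neq0 S.
have := kaut_curve s; rewrite sx sy !exprMn exprVn -!rmorphXn.
set C := c ^+ m; set E := d ^+ m => H.
have C0 : C != 0 by rewrite expf_neq0.
have [q0 _ q2] : [/\ a * C * E + C = 0, - a * C * E + a * C + E - 1 = 0 & - E - a = 0].
  apply: quad_zero; rewrite !(rmorphD, rmorphN, rmorphM, rmorph1) /=.
  have u0 : x ^+ m != 0 by rewrite expf_neq0.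
  move: u0 H vE (cs_au1_neq0 S); set u := x ^+ m; set v := y ^+ m => u0 H vE' au0.
  transitivity (j a * (j C) * (j E) * (v * (j a * u + 1)) +
    j C * (j a * u + 1) + j E * u * (v * (j a * u + 1)) - u * (j a * u + 1)).
    by rewrite vE'; ring.
  transitivity ((j a * u + 1) * u *
     (j a * (j C / u) * (j E * v) + j C / u + j E * v - 1)); first by field.
  by rewrite H subrr mulr0.
have Ea : E = - a by apply/eqP; rewrite -addr_eq0 -oppr_eq0 opprD q2.
have : (a - 1) * (a + 1) * C = 0.
  by rewrite -oppr0 -q0 Ea; ring.
move/eqP; rewrite !mulf_eq0 (negPf C0) (negPf (cs_a1_neq0 S)) !orbF subr_eq0.
by move/eqP.
Qed.

End StraightUnits.

(** * Groups given by normal forms *)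

Section GroupIso.
Local Open Scope group_scope.

(** The indices may be redundant, as long as both maps identify the same ones;
    this allows words with natural exponents instead of residues. *)
Lemma iso_of_param (I : Type) (A B : groupType) (eA : I -> A) (eB : I -> B)
    (mu : I -> I -> I) :
  (forall z, exists p, z = eA p) -> (forall z, exists p, z = eB p) ->
  (forall p q, eA p = eA q <-> eB p = eB q) ->
  (forall p q, eA p * eA q = eA (mu p q)) ->
  (forall p q, eB p * eB q = eB (mu p q)) -> isomorphic A B.
Proof.
move=> sA sB eq_e mA mB.
pose cA z := sval (cid (sA z)); pose cB z := sval (cid (sB z)).
have cAK z : eA (cA z) = z by rewrite /cA; case: cid.
have cBK z : eB (cB z) = z by rewrite /cB; case: cid.
pose f z := eB (cA z).
have fe p : f (eA p) = eB p by apply/eq_e; rewrite cAK.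
have fM : {morph f : z w / z * w}.
  by move=> z w; rewrite -{1}[z]cAK -{1}[w]cAK mA fe -mB.
pose F : {multiplicative A -> B} := HB.pack f (isMultiplicative.Build _ _ f fM).
exists F; exists (fun z => eA (cB z)) => z /=.
  by rewrite -[RHS]cAK; apply/eq_e; rewrite cBK.
by rewrite -[RHS]cBK; apply/eq_e; rewrite cAK.
Qed.

Section Words.
Variables (A : groupType).
Implicit Types r t : A.

Lemma expg_modn r n i : r ^+ n = 1 -> r ^+ (i %% n) = r ^+ i.
Proof.
by move=> rn; rewrite [in RHS](divn_eq i n) expgnDr mulnC expgnA rn expg1n mul1g.
Qed.

(** The product of the words r^i t^j, moving t^j across r^k by
    t r = r^3 t.  The exponents are natural numbers, not residues, so that no
    reduction is needed. *)
Definition dihedral_mul (p q : nat * nat) :=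
  (p.1 + 3 ^ p.2 * q.1, p.2 + q.2)%N.

Section Dihedral.
Variables r t : A.
Hypotheses (r4 : r ^+ 4 = 1) (t2 : t ^+ 2 = 1) (trE : t * r = r ^+ 3 * t).
Hypothesis free : forall i j, r ^+ i * t ^+ j = 1 -> (4 %| i)%N /\ (2 %| j)%N.

Lemma dihedral_comm j k : t ^+ j * r ^+ k = r ^+ (3 ^ j * k) * t ^+ j.
Proof.
have t1 l : t * r ^+ l = r ^+ (3 * l) * t.
  elim: l => [|l IHl]; first by rewrite muln0 !expg0 mulg1 mul1g.
  by rewrite expgS mulgA trE -mulgA IHl mulgA -expgnDr mulnS.
elim: j k => [|j IHj] k; first by rewrite expn0 mul1n !expg0 mulg1 mul1g.
by rewrite expgS -mulgA IHj mulgA t1 expnS -mulgA mulnA.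
Qed.

Lemma dihedral_wordM p q : r ^+ p.1 * t ^+ p.2 * (r ^+ q.1 * t ^+ q.2) =
  r ^+ (dihedral_mul p q).1 * t ^+ (dihedral_mul p q).2.
Proof.
rewrite /= !expgnDr -!mulgA; congr (_ * _); rewrite !mulgA dihedral_comm.
by [].
Qed.

Lemma dihedral_word_eq p q : r ^+ p.1 * t ^+ p.2 = r ^+ q.1 * t ^+ q.2 <->
  p.1 = q.1 %[mod 4] /\ p.2 = q.2 %[mod 2].
Proof.
split=> [E|[E1 E2]]; last first.
  rewrite -(expg_modn p.1 r4) E1 (expg_modn _ r4).
  by rewrite -(expg_modn p.2 t2) E2 (expg_modn _ t2).
have tK l : t ^+ l * t ^+ l = 1.
  by rewrite -expgnDr addnn -mul2n expgnA t2 expg1n.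
have E' : r ^+ (3 * q.1 + p.1) * t ^+ (p.2 + q.2) = 1.
  transitivity (r ^+ (3 * q.1) * (r ^+ p.1 * t ^+ p.2) * t ^+ q.2).
    by rewrite !expgnDr !mulgA.
  rewrite E mulgA -expgnDr -mulgA tK mulg1 addnC -mulSn.
  by rewrite expgnA r4 expg1n.
by have [] := free E'; lia.
Qed.

End Dihedral.
End Words.

Lemma dihedral_iso (A : groupType) (r t : A) :
  r ^+ 4 = 1 -> t ^+ 2 = 1 -> t * r = r ^+ 3 * t ->
  (forall i j, r ^+ i * t ^+ j = 1 -> (4 %| i)%N /\ (2 %| j)%N) ->
  (forall z, exists i j, z = r ^+ i * t ^+ j) -> isomorphic A ('D_8)%type.
Proof.
move=> r4 t2 tr free surj.
(* The generators of the dihedral group of order 8 = 2 ^ 3, of orders 4 and 2. *)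
have [[u v] [card_D Gu ou /setDP[_ Uv]] [ov uv]] :=
  @generators_2dihedral _ 'D_8%G 3 isT (isog_refl _).
have u4 : u ^+ 4 = 1 by have := expg_order u; rewrite ou.
have v2 : v ^+ 2 = 1 by have := expg_order v; rewrite ov.
have vK : v * v = 1 by rewrite -expg2.
have vu : v * u = u ^+ 3 * v.
  have u3 : u ^+ 3 = u^-1 by apply: (mulgI u); rewrite -expgS u4 mulgV.
  have vV : v^-1 = v by apply: (mulgI v); rewrite mulgV vK.
  by rewrite u3 -uv conjgE vV -!mulgA vK mulg1.
have freeD i l : u ^+ i * v ^+ l = 1 -> (4 %| i)%N /\ (2 %| l)%N.
  move=> E; have l2 : (2 %| l)%N.
    rewrite dvdn2; apply/negP => ol; case/negP: Uv.
    have vl : v ^+ l = v by rewrite -(expg_modn l v2) modn2 ol expg1.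
    by rewrite vl in E; rewrite -groupV; have <- : u ^+ i = v^-1
      by [apply: (mulIg v); rewrite E mulVg]; apply: mem_cycle.
  split=> //; have vl : v ^+ l = 1.
    by rewrite -(expg_modn l v2) (eqP l2) expg0.
  by rewrite vl mulg1 in E; have := order_dvdn u i; rewrite ou E eqxx.
pose eA p := r ^+ p.1 * t ^+ p.2; pose eD p := u ^+ p.1 * v ^+ p.2.
apply: (iso_of_param (I := (nat * nat)%type) (eA := eA) (eB := eD) (mu := dihedral_mul)).
- by move=> z; have [i [l ->]] := surj z; exists (i, l).
- pose h (p : 'I_4 * 'I_2) := eD (nat_of_ord p.1, nat_of_ord p.2).
  have h_inj : injective h.
    move=> [p1 p2] [q1 q2] /(dihedral_word_eq u4 v2 freeD)[/= E1 E2].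
    rewrite !modn_small // in E1 E2.
    by congr (_, _); apply: val_inj.
  have hT : (#|{: gsort ('D_8)%type}| <= #|{: 'I_4 * 'I_2}|)%N.
    by rewrite card_prod !card_ord -cardsT card_D.
  move=> z; have /codomP[p ->] := inj_card_onto h_inj hT z.
  by exists (nat_of_ord p.1, nat_of_ord p.2).
- move=> p q; apply: iff_trans (dihedral_word_eq r4 t2 free p q) _.
  exact: iff_sym (dihedral_word_eq u4 v2 freeD p q).
- exact: dihedral_wordM tr.
- exact: dihedral_wordM vu.
Qed.

Lemma klein_iso (A : groupType) (u v : A) :
  u ^+ 2 = 1 -> v ^+ 2 = 1 -> v * u = u * v ->
  (forall i j, u ^+ i * v ^+ j = 1 -> (2 %| i)%N /\ (2 %| j)%N) ->
  (forall z, exists i j, z = u ^+ i * v ^+ j) -> isomorphic A ('Z_2 * 'Z_2)%type.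
Proof.
move=> u2 v2 vu free surj.
have comm i l : v ^+ l * u ^+ i = u ^+ i * v ^+ l.
  by apply: commuteX2; rewrite /commute vu.
pose eA (p : nat * nat) := u ^+ p.1 * v ^+ p.2.
pose eB (p : nat * nat) : 'Z_2 * 'Z_2 := (inZp p.1, inZp p.2).
have eBM p q : eB p * eB q = eB (p.1 + q.1, p.2 + q.2)%N.
  by congr (_, _); apply: val_inj; rewrite /= modnDm.
have eAM p q : eA p * eA q = eA (p.1 + q.1, p.2 + q.2)%N.
  rewrite /eA /= !expgnDr -!mulgA; congr (_ * _); rewrite !mulgA comm.
  by [].
apply: (iso_of_param (eA := eA) (eB := eB)
  (mu := fun p q => (p.1 + q.1, p.2 + q.2)%N)) => //.
- by move=> z; have [i [l ->]] := surj z; exists (i, l).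
- by move=> [z1 z2]; exists (nat_of_ord z1, nat_of_ord z2); rewrite /eB /= !valZpK.
move=> p q; have -> : eB p = eB q <-> p.1 = q.1 %[mod 2] /\ p.2 = q.2 %[mod 2].
  split=> [[E1 E2]|[E1 E2]]; last by congr (_, _); apply: val_inj.
  by split; [apply: E1|apply: E2].
split=> [E|[E1 E2]]; last first.
  rewrite /eA -(expg_modn p.1 u2) E1 (expg_modn _ u2).
  by rewrite -(expg_modn p.2 v2) E2 (expg_modn _ v2).
have E' : u ^+ (p.1 + q.1) * v ^+ (p.2 + q.2) = 1.
  have := eAM p q; rewrite {1}/eA -/(eA p) E eAM /eA /= !addnn -!mul2n !expgnA u2 v2.
  by rewrite !expg1n mulg1 => <-.
by have [] := free _ _ E'; lia.
Qed.

End GroupIso.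

(** * The quotient by the group of rotations *)

Section Classification.
Variables (K : closedFieldType) (L : fieldType) (j : {rmorphism K -> L}).
Variables (x y : L) (a zeta : K) (m : nat).
Hypothesis S : curve_setting j x y a zeta m.
Let S' := curve_setting_swap S.
Let x0 := cs_y_neq0 S'.
Let y0 := cs_y_neq0 S.
Notation inT := (in_torus j x y m).

Section Cases.
Variables (g1 g2 : kaut j).
Hypotheses (g1x : g1 x = j zeta * x) (g1y : g1 y = y).
Hypotheses (g2x : g2 x = x) (g2y : g2 y = j zeta * y).

(** The four choices of signs of the exponents; mixed signs require a = 1. *)
Lemma straight_cases (s : kaut j) : straight x y g1 g2 s -> exists c d, [/\ c != 0, d != 0 &
  [\/ s x = j c * x /\ s y = j d * y, s x = j c / x /\ s y = j d / y,
      [/\ a = 1, s x = j c * x & s y = j d / y] |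
      [/\ a = 1, s x = j c / x & s y = j d * y]]].
Proof.
move=> sS; have sS' : straight y x g2 g1 s by case: sS.
have [c [c0 sx]] := straight_unit S g1x g1y g2x g2y sS.
have [d [d0 sy]] := straight_unit S' g2y g2x g1y g1x sS'.
exists c, d; split=> //.
case: sx => sx; case: sy => sy.
- by constructor 1.
- by constructor 3; split=> //; apply: (flip_forces_a1 S' d0 sy sx).
- by constructor 4; split=> //; apply: (flip_forces_a1 S c0 sx sy).
- by constructor 2.
Qed.

Lemma crossed_swap (s w : kaut j) : w x = y -> w y = x -> crossed x y g1 g2 s ->
  straight x y g1 g2 (s * w)%g.
Proof. by move=> wx wy [h2 h1]; split; rewrite kautM ?wx ?wy. Qed.

End Cases.

Variables (w s0 : kaut j) (b : K).
Hypotheses (wx : w x = y) (wy : w y = x).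
Hypotheses (bm : b ^+ m = - a^-1) (s0x : s0 x = j b / x) (s0y : s0 y = j b / y).

Lemma exists_straight (s : kaut j) : exists i (g1 g2 : kaut j),
  [/\ g1 x = j zeta * x, g1 y = y, g2 x = x, g2 y = j zeta * y &
      straight x y g1 g2 (s * w ^+ i)%g].
Proof.
have z1 := prim_expr_order (cs_zeta_prim S).
have [g1 [g1x g1y]] := torus_exists S z1 (expr1n _ m).
have [g2 [g2x g2y]] := torus_exists S (expr1n _ m) z1.
rewrite rmorph1 mul1r in g1y; rewrite rmorph1 mul1r in g2x.
case: (straight_or_crossed S g1x g1y g2x g2y s) => h.
  by exists 0%N, g1, g2; rewrite expg0 mulg1.
by exists 1%N, g1, g2; rewrite expg1; split=> //; apply: crossed_swap.
Qed.

Lemma classification_generic (s : kaut j) : a != 1 ->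
  exists i k, inT (s * (w ^+ i * s0 ^+ k))%g.
Proof.
move=> a1; have [i [g1 [g2 [g1x g1y g2x g2y sS]]]] := exists_straight s.
suff [k H] : exists k, inT (s * w ^+ i * s0 ^+ k)%g by exists i, k; rewrite mulgA.
move: sS; pose t : kaut j := (s * w ^+ i)%g; rewrite -/t; clearbody t => sS.
have [c [d [c0 d0]]] := straight_cases g1x g1y g2x g2y sS.
have jc0 : j c != 0 by rewrite fmorph_eq0.
have jd0 : j d != 0 by rewrite fmorph_eq0.
case=> [[sx sy]|[sx sy]|[E]|[E]]; try by rewrite E eqxx in a1.
  exists 0%N; rewrite expg0 mulg1.
  exact: (scaling_in_torus S sx sy).
exists 1%N; rewrite expg1.
apply: (scaling_in_torus S (c := b / c) (d := b / d)).
  by rewrite kautM s0x !fmorph_div /= kautj sx; field; rewrite jc0 x0.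
by rewrite kautM s0y !fmorph_div /= kautj sy; field; rewrite jd0 y0.
Qed.

Lemma classification_flip (s f : kaut j) (eps : K) : f x = j eps * x -> f y = y^-1 -> eps != 0 ->
  exists i k l, inT (s * (w ^+ i * s0 ^+ k * f ^+ l))%g.
Proof.
move=> fx fy e0; have [i [g1 [g2 [g1x g1y g2x g2y sS]]]] := exists_straight s.
suff [k [l H]] : exists k l, inT (s * w ^+ i * s0 ^+ k * f ^+ l)%g.
  by exists i, k, l; rewrite !mulgA.
move: sS; pose t : kaut j := (s * w ^+ i)%g; rewrite -/t; clearbody t => sS.
have [c [d [c0 d0]]] := straight_cases g1x g1y g2x g2y sS.
have je0 : j eps != 0 by rewrite fmorph_eq0.
have jc0 : j c != 0 by rewrite fmorph_eq0.
have jd0 : j d != 0 by rewrite fmorph_eq0.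
have b0 := inversion_base_neq0 S bm; have jb0 : j b != 0 by rewrite fmorph_eq0.
case=> [[sx sy]|[sx sy]|[_ sx sy]|[_ sx sy]].
- exists 0%N, 0%N; rewrite !expg0 !mulg1.
  exact: (scaling_in_torus S sx sy).
- exists 1%N, 0%N; rewrite expg1 expg0 mulg1.
  apply: (scaling_in_torus S (c := b / c) (d := b / d)).
    by rewrite kautM s0x !fmorph_div /= kautj sx; field; rewrite jc0 x0.
  by rewrite kautM s0y !fmorph_div /= kautj sy; field; rewrite jd0 y0.
- exists 0%N, 1%N; rewrite expg0 expg1 mulg1.
  apply: (scaling_in_torus S (c := eps * c) (d := d^-1)).
    by rewrite kautM fx !rmorphM /= kautj sx; ring.
  by rewrite kautM fy !fmorphV /= sy; field; rewrite jd0 y0.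
exists 1%N, 1%N; rewrite !expg1.
apply: (scaling_in_torus S (c := eps * b / c) (d := d / b)).
  rewrite !kautM fx (rmorphM s0) /= kautj s0x (rmorphM t) (fmorph_div t) /=. rewrite !kautj sx.
  by rewrite fmorph_div rmorphM /=; field; rewrite jc0 x0.
rewrite !kautM fy fmorphV /= s0y (fmorphV t) (fmorph_div t) /= kautj sy fmorph_div.
by field; rewrite jb0 jd0 y0.
Qed.

Lemma torus_power_x t : inT t -> t x ^+ m = x ^+ m.
Proof. by move=> [c [d [cm dm -> _]]]; rewrite exprMn -rmorphXn cm rmorph1 mul1r. Qed.

(** Each equality would make x^m a root of a nonzero quadratic polynomial. *)
Lemma power_distinct (e : K) : e != 0 ->
  [/\ x ^+ m != j e * y ^+ m, x ^+ m != j e / x ^+ m & x ^+ m != j e / y ^+ m].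
Proof.
move=> e0.
have u0 : x ^+ m != 0 by rewrite expf_neq0.
have v0 : y ^+ m != 0 by rewrite expf_neq0.
have vE := cs_kummer_eq S.
have Q := quad_zero S.
split; apply/negP => /eqP E.
- have [/eqP] : [/\ - e = 0, 1 + e = 0 & a = 0].
    apply: Q; rewrite rmorphN rmorphD rmorph1.
    transitivity (x ^+ m * (j a * x ^+ m + 1) - j e * (1 - x ^+ m)); first by ring.
    by rewrite {1}E -vE; ring.
  by rewrite oppr_eq0 (negPf e0).
- have [_ _ /eqP] : [/\ - e = 0, 0 = 0 :> K & 1 = 0 :> K].
    apply: Q; rewrite rmorphN rmorph1 rmorph0 expr2 {1}E divfK //; ring.
  by rewrite oner_eq0.
have [_ _ /eqP] : [/\ - e = 0, 1 - e * a = 0 & -1 = 0 :> K].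
  apply: Q; rewrite rmorphB rmorphM !rmorphN rmorph1.
  transitivity (x ^+ m * (1 - x ^+ m) - j e * (j a * x ^+ m + 1)); first by ring.
  by rewrite -vE mulrA {1}E divfK // subrr.
by rewrite oppr_eq0 oner_eq0.
Qed.

Variable nG : is_normal (torus_group j x y zeta).
Notation pi := (quotient_pi nG).

Lemma pi_eq (s t : kaut j) : pi s = pi t <-> inT (s^-1 * t)%g.
Proof.
by split=> [/(quotient_piP nG)/(torus_groupP S)|/(torus_groupP S)/(quotient_piP nG)].
Qed.

Lemma pi_eq1 (s : kaut j) : pi s = 1%g <-> inT s.
Proof.
split=> [E|H].
  have /pi_eq : pi 1%g = pi s by rewrite E.
  by rewrite invg1 mul1g.
by apply: esym; apply: (pi_eq 1%g s).2; rewrite invg1 mul1g.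
Qed.

Lemma piM (s t : kaut j) : pi (s * t)%g = (pi s * pi t)%g.
Proof. exact: quotient_piM. Qed.

Lemma piX (s : kaut j) i : pi (s ^+ i)%g = (pi s ^+ i)%g.
Proof. by elim: i => [|i IHi]; rewrite ?expg0 // !expgS piM IHi. Qed.

Lemma pi_surj (z : quotient_by nG) : exists s, z = pi s.
Proof. by eexists; apply: esym; apply: quotient_reprK. Qed.

Lemma pi_scale (s t : kaut j) c d :
  t x = j c * s x -> t y = j d * s y -> pi s = pi t.
Proof.
move=> tx ty; apply/pi_eq; apply: (scaling_in_torus S (c := c) (d := d)).
  by rewrite kautM tx kautZ kautK.
by rewrite kautM ty kautZ kautK.
Qed.

(** No product of the swap and the inversion other than the trivial one is in
    the group of rotations, because rotations fix x^m. *)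
Lemma quotient_generic : a != 1 -> isomorphic (quotient_by nG) ('Z_2 * 'Z_2)%type.
Proof.
move=> a1; have b0 := inversion_base_neq0 S bm.
have jb0 : j b != 0 by rewrite fmorph_eq0.
have w2 : (pi w ^+ 2)%g = 1%g.
  rewrite -piX; apply/pi_eq1; apply: (scaling_in_torus S (c := 1) (d := 1));
    by rewrite expg2 kautM ?wx ?wy ?wx ?wy rmorph1 mul1r.
have s2 : (pi s0 ^+ 2)%g = 1%g.
  rewrite -piX; apply/pi_eq1; apply: (scaling_in_torus S (c := 1) (d := 1)).
    by rewrite expg2 kautM s0x fmorph_div /= kautj s0x rmorph1; field; rewrite jb0 x0.
  by rewrite expg2 kautM s0y fmorph_div /= kautj s0y rmorph1; field; rewrite jb0 y0.
apply: (klein_iso (u := pi w) (v := pi s0)) => //.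
- rewrite -!piM; apply: (pi_scale (c := 1) (d := 1)).
    by rewrite !kautM wx s0x fmorph_div /= kautj wx s0y rmorph1 mul1r.
  by rewrite !kautM wy s0y fmorph_div /= kautj wy s0x rmorph1 mul1r.
- move=> i k; rewrite -(expg_modn i w2) -(expg_modn k s2) !modn2 !dvdn2 -!piX -piM.
  move/pi_eq1 => /torus_power_x.
  have bm0 : b ^+ m != 0 by rewrite expf_neq0.
  have [_ n2 n3] := power_distinct bm0; have [n1 _ _] := power_distinct (oner_neq0 K).
  rewrite rmorph1 mul1r in n1.
  case: (odd i); case: (odd k); rewrite ?expg0 ?expg1 ?mulg1 ?mul1g ?kautM => /eqP //.
  + by rewrite s0x fmorph_div /= kautj wx exprMn exprVn -rmorphXn eq_sym (negPf n3).
  + by rewrite wx eq_sym (negPf n1).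
  by rewrite s0x exprMn exprVn -rmorphXn eq_sym (negPf n2).
move=> z; have [s ->] := pi_surj z.
have [i [k H]] := classification_generic s^-1%g a1.
by exists i, k; rewrite -!piX -piM; apply/pi_eq.
Qed.

(** The element r of order 4 is the flip times the swap; its square is the
    inversion modulo rotations.  A word in r and the swap that fixes x^m is
    trivial, since its image of x^m is c x^(m e) or c y^(m e) with c, e = 1 or
    -1. *)
Lemma quotient_flip (f : kaut j) : a = 1 -> f x = j b * x -> f y = y^-1 ->
  isomorphic (quotient_by nG) 'D_8.
Proof.
move=> a1 fx fy; have b0 := inversion_base_neq0 S bm.
have jb0 : j b != 0 by rewrite fmorph_eq0.
have [r [rx ry]] : exists r : kaut j, r x = y^-1 /\ r y = j b * x.
  by exists (f * w)%g; rewrite !kautM wx wy fx fy.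
have r2x : (r ^+ 2)%g x = (j b * x)^-1 by rewrite expg2 kautM rx kautV ry.
have r2y : (r ^+ 2)%g y = j b / y by rewrite expg2 kautM ry kautZ rx.
have r3x : (r ^+ 3)%g x = y / j b.
  by rewrite expgSr kautM rx kautV r2y; field; rewrite jb0 y0.
have r3y : (r ^+ 3)%g y = x^-1.
  by rewrite expgSr kautM ry kautZ r2x; field; rewrite jb0 x0.
have r4 : (pi r ^+ 4)%g = 1%g.
  rewrite -piX; apply/pi_eq1; apply: (scaling_in_torus S (c := 1) (d := 1)).
    by rewrite expgSr kautM rx kautV r3y invrK rmorph1 mul1r.
  by rewrite expgSr kautM ry kautZ r3x rmorph1; field.
have w2 : (pi w ^+ 2)%g = 1%g.
  rewrite -piX; apply/pi_eq1; apply: (scaling_in_torus S (c := 1) (d := 1));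
    by rewrite expg2 kautM ?wx ?wy ?wx ?wy rmorph1 mul1r.
have wr : (pi w * pi r = pi r ^+ 3 * pi w)%g.
  rewrite -!piX -!piM; apply: (pi_scale (c := 1) (d := b^-1 ^+ 2)).
    by rewrite (kautM _ w) (kautM w) wx rx kautV wy r3y rmorph1 mul1r.
  rewrite (kautM _ w) (kautM w) wy ry kautZ wx r3x rmorphXn fmorphV; field.
  by [].
have r2s : pi s0 = (pi r ^+ 2)%g.
  rewrite -piX; apply: (pi_scale (c := b^-1 ^+ 2) (d := 1)).
    by rewrite r2x s0x rmorphXn fmorphV; field; rewrite jb0 x0.
  by rewrite r2y s0y rmorph1 mul1r.
have fE : pi f = (pi r * pi w)%g.
  rewrite -piM; apply: (pi_scale (c := 1) (d := 1)).
    by rewrite kautM wx ry fx rmorph1 mul1r.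
  by rewrite kautM wy rx fy rmorph1 mul1r.
have bm1 : b ^+ m = -1 by rewrite bm a1 invr1.
apply: (dihedral_iso (r := pi r) (t := pi w)) => //.
- have two0 : 1 + 1 != 0 :> K by have := cs_a1_neq0 S; rewrite a1.
  have [n1 n2 n3] := power_distinct (oner_neq0 K).
  have N1 : -1 != 0 :> K by rewrite oppr_eq0 oner_eq0.
  have [n4 n5 n6] := power_distinct N1.
  have n7 : x ^+ m != j (-1) * x ^+ m.
    rewrite -{1}[x ^+ m]mul1r -{1}(rmorph1 j).
    rewrite (inj_eq (mulIf (expf_neq0 m x0))) (inj_eq (fmorph_inj j)).
    by rewrite -addr_eq0.
  rewrite rmorph1 in n1 n2 n3.
  have bmL : j b ^+ m = j (-1) by rewrite -rmorphXn bm1.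
  have jN1V : (j (-1))^-1 = j (-1) by rewrite -fmorphV invrN1.
  move=> i k; rewrite -(expg_modn i r4) -(expg_modn k w2) -!piX -piM.
  move/pi_eq1 => /torus_power_x; rewrite /dvdn.
  have := ltn_pmod k (isT : 0 < 2)%N; have := ltn_pmod i (isT : 0 < 4)%N.
  case: (i %% 4)%N => [|[|[|[|]]]] // _; case: (k %% 2)%N => [|[|]] // _;
    rewrite ?expg0 ?expg1 ?mulg1 ?mul1g ?(kautM _ w) ?wx ?rx ?ry ?r2x ?r2y ?r3x ?r3y => /esym/eqP;
    rewrite ?exprVn ?exprMn ?exprVn ?invfM ?bmL ?jN1V.
  + by rewrite -[y ^+ m]mul1r (negPf n1).
  + by rewrite -[_^-1]mul1r (negPf n3).
  + by rewrite (negPf n7).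
  + by rewrite (negPf n5).
  + by rewrite (negPf n6).
  + by rewrite mulrC (negPf n4).
  by rewrite -[_^-1]mul1r (negPf n2).
move=> z; have [s ->] := pi_surj z.
have [i [k [l /pi_eq H]]] := classification_flip s^-1%g fx fy b0.
rewrite !piM !piX fE r2s in H.
(* Words in r and w are closed under products. *)
pose word z' := exists i l, z' = (pi r ^+ i * pi w ^+ l)%g.
have wordM z1 z2 : word z1 -> word z2 -> word (z1 * z2)%g.
  move=> [i1 [l1 ->]] [i2 [l2 ->]].
  exists (dihedral_mul (i1, l1) (i2, l2)).1, (dihedral_mul (i1, l1) (i2, l2)).2.
  exact: (dihedral_wordM wr (i1, l1) (i2, l2)).
have wordX z1 n : word z1 -> word (z1 ^+ n)%g.
  move=> z1w; elim: n => [|n IHn]; last by rewrite expgS; apply: wordM.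
  by exists 0%N, 0%N; rewrite !expg0 mulg1.
have word_r : word (pi r) by exists 1%N, 0%N; rewrite expg1 expg0 mulg1.
have word_w : word (pi w) by exists 0%N, 1%N; rewrite expg1 expg0 mul1g.
rewrite -/(word (pi s)) H; apply: (wordM _ _ _ (wordX _ _ (wordM _ _ word_r word_w))).
by apply: (wordM _ _ (wordX _ _ word_w)); do 2!apply: (wordX).
Qed.

End Classification.

Theorem theorem6p17 (p h m : nat) (F : finFieldType) (K : closedFieldType)
    (iota : {rmorphism F -> K}) (a zeta : K)
    (L : fieldType) (j : {rmorphism K -> L}) (x y : L)
    (p_prime : prime p) (p_gt2 : (2 < p)%N) (card_F : #|F| = (p ^ h)%N)
    (K_closure : is_algebraic_closure iota)
    (m_gt2 : (2 < m)%N) (m_coprime_p : coprime m p) (a_neq0 : a != 0)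
    (irr : irreducible_elt (curve_poly a m))
    (L_function_field : is_function_field j x y (curve_poly a m))
    (zeta_prim : m.-primitive_root zeta) :
  subgroup_isomorphic (torus_group j x y zeta) ('Z_m * 'Z_m)%type /\
  exists nG : is_normal (torus_group j x y zeta),
    (a != 1 -> isomorphic (quotient_by nG) ('Z_2 * 'Z_2)%type) /\
    (a = 1 -> isomorphic (quotient_by nG) 'D_8).
Proof.
have S : curve_setting j x y a zeta m by split.
split; first exact: torus_isomorphic S.
have z1 := prim_expr_order zeta_prim.
have [g1 [g1x g1y]] := torus_exists S z1 (expr1n _ m).
have [g2 [g2x g2y]] := torus_exists S (expr1n _ m) z1.
rewrite rmorph1 mul1r in g1y; rewrite rmorph1 mul1r in g2x.
exists (torus_normal S g1x g1y g2x g2y).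
have [w [wx wy]] := swap_exists S.
have [b bm] := root_exists (- a^-1) (cs_m_gt0 S).
have [s0 [s0x s0y]] := inversion_exists S bm.
split=> a1; first exact: (quotient_generic S wx wy bm s0x s0y).
have bm1 : b ^+ m = -1 by rewrite bm a1 invr1.
have [f [fx fy]] := flip_exists S a1 bm1.
exact: (quotient_flip S wx wy bm s0x s0y _ a1 fx fy).
Qed.
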